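(* Let $d\mu$ be a probability measure on $\partial\mathbb{D}$ whose Verblunsky coefficients $(\alpha_n)_{n\ge 0}$ satisfy $$\alpha_n \to L \in \mathbb{D}\setminus\{0\}, \qquad \sum_{j=0}^{\infty} |\alpha_{j+1}-\alpha_j| < \infty .$$ Let $\mathbb{G}_L=\{e^{i\theta}: -\theta_{|L|}<\theta<\theta_{|L|}\}$, $\theta_{|L|}=2\arcsin(|L|)$, be the gap of the essential spectrum (not including the endpoints). Let $\zeta=e^{i\theta}\in\mathbb{G}_L$ with $\theta\in(-\theta_{|L|},\theta_{|L|})$, let $0<\gamma<1$, and let $d\nu=(1-\gamma)\,d\mu+\gamma\,\delta_\zeta$. Then one of the following is true. (1) If $\mu(\{\zeta\})>0$, then the three sequences $(|\varphi_n(\zeta)|)_n$, $(\Delta_n(\zeta))_n$ and $(\alpha_n(d\nu)-\alpha_n(d\mu))_n$ tend to zero exponentially fast. (2) If $\mu(\{\zeta\})=0$, then: (a) $\lim_{n\to\infty}\Delta_n(\zeta)$ exists, and $$\Delta_\infty(\zeta)\equiv\lim_{n\to\infty}\Delta_n(\zeta)=\overline{h(\zeta)^{1/2}}\left[\frac{(\zeta-1)-h(\zeta)^{1/2}}{2\overline{L}}\right],\qquad h(\zeta)=(\zeta-1)^2+4\zeta|L|^2,$$ where the square root is the branch with $1^{1/2}=1$ (the principal branch on $\mathbb{C}\setminus(-\infty,0]$). (b) Furthermore $|\Delta_\infty(\zeta)+L|=|L|$, and $\lim_{n\to\infty}\alpha_n(d\nu)=Le^{i\omega}$, where $$\cos\omega=\frac{2\sin^2(\theta/2)-|L|^2}{|L|^2},\qquad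 \sin\omega=\frac{2\sin(\theta/2)\sqrt{|L|^2-\sin^2(\theta/2)}}{|L|^2}.$$ (c) $(\Delta_n(\zeta))_n$ is of bounded variation, i.e. $\sum_{n=0}^\infty|\Delta_{n+1}(\zeta)-\Delta_n(\zeta)|<\infty$.
   Context: $\mathbb{D}$ is the open unit disc in $\mathbb{C}$ and $\partial\mathbb{D}$ the unit circle. For a probability measure $d\mu$ on $\partial\mathbb{D}$ with infinite support, $\Phi_n(z)$ are the monic orthogonal polynomials in $L^2(\partial\mathbb{D},d\mu)$, $\varphi_n=\Phi_n/\|\Phi_n\|_{d\mu}$ the orthonormal polynomials, $\Phi_n^*(z)=z^n\overline{\Phi_n(1/\bar z)}$ and $\varphi_n^*(z)=z^n\overline{\varphi_n(1/\bar z)}$. The Verblunsky coefficients $\alpha_n=\alpha_n(d\mu)\in\mathbb{D}$, $n\ge0$, are defined by the Szegő recursion $\Phi_{n+1}(z)=z\Phi_n(z)-\overline{\alpha_n}\Phi_n^*(z)$. Objects without the label $(d\nu)$ are associated with $d\mu$; $\alpha_n(d\nu)$ are the Verblunsky coefficients of $d\nu$. For $\zeta\in\partial\mathbb{D}$ and $0<\gamma<1$, $$\Delta_n(\zeta)=\frac{(1-|\alpha_n|^2)^{1/2}\,\overline{\varphi_{n+1}(\zeta)}\,\varphi_n^*(\zeta)}{(1-\gamma)\gamma^{-1}+K_n(\zeta,\zeta)},\qquad K_n(\zeta,\zeta)=\sum_{j=0}^n|\varphi_j(\zeta)|^2 .$$ It is known that $\alpha_n(d\nu)=\alpha_n(d\mu)+\Delta_n(\zeta)$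 for $d\nu=(1-\gamma)d\mu+\gamma\delta_\zeta$. A sequence $(a_n)$ tends to zero exponentially fast if $|a_n|\le Cr^n$ for some $C>0$, $0<r<1$. *)

(* Defs.v *)
From HB Require Import structures.
From mathcomp Require Import all_boot all_order all_algebra.
From mathcomp Require Import all_classical all_reals all_analysis.
From mathcomp Require Export complex.

Set Implicit Arguments.
Unset Strict Implicit.
Unset Printing Implicit Defensive.
Import Order.TTheory GRing.Theory Num.Theory.
Import numFieldNormedType.Exports.
Export Normc.

Local Open Scope classical_set_scope.
Local Open Scope ring_scope.
Local Open Scope complex_scope.

(* R[i] itself carries no topology in the library, but its regular module
   R[i]^o does: the one given by the modulus. *)
Notation borelC R := (g_sigma_algebraType (@open (R[i]^o))).

Section OPUC.
Context {R : realType}.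
Implicit Types (mu : {measure set (borelC R) -> \bar R}) (p q : {poly R[i]}).

Definition unit_circle : set R[i] := [set z | normc z = 1].

Definition expi (t : R) : R[i] := cos t +i* sin t.

Definition msupport mu : set R[i] :=
  [set z | forall U : set R[i]^o, open U -> U z -> (0 < mu U)%E].

Definition circle_integral mu (f : R[i] -> R[i]) : R[i] :=
  (\int[mu]_(z in (unit_circle : set (borelC R))) complex.Re (f z)) +i*
  (\int[mu]_(z in (unit_circle : set (borelC R))) complex.Im (f z)).

Definition inner mu p q : R[i] :=
  circle_integral mu (fun z => conjc p.[z] * q.[z]).

Definition norm2 mu p : R :=
  Num.sqrt (\int[mu]_(z in (unit_circle : set (borelC R))) (normc p.[z]) ^+ 2).

Definition is_monic_orthogonal mu (n : nat) p : Prop :=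
  [/\ p \is monic, size p = n.+1 &
      forall q, (size q <= n)%N -> inner mu q p = 0].

(* The polynomial below is unique when mu has infinite support. *)
Definition monic_op mu (n : nat) : {poly R[i]} :=
  xget 0 [set p | is_monic_orthogonal mu n p].

Definition orthonormal_op mu (n : nat) : {poly R[i]} :=
  ((norm2 mu (monic_op mu n))^-1)%:C *: monic_op mu n.

(* As a polynomial, z^n * conj (p (1 / conj z)) has the conjugated coefficients
   of p in reverse order; see horner_rev_poly. *)
Definition rev_poly (n : nat) p : {poly R[i]} :=
  \poly_(i < n.+1) conjc p`_(n - i).

Definition verblunsky mu (n : nat) : R[i] :=
  xget 0 [set a : R[i] | monic_op mu n.+1 =
    'X * monic_op mu n - conjc a *: rev_poly n (monic_op mu n)].

Definition CD_kernel mu (n : nat) (zeta : R[i]) : R :=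
  \sum_(j < n.+1) (normc (orthonormal_op mu j).[zeta]) ^+ 2.

Definition Delta mu (gamma : R) (zeta : R[i]) (n : nat) : R[i] :=
  (Num.sqrt (1 - (normc (verblunsky mu n)) ^+ 2))%:C
  * conjc (orthonormal_op mu n.+1).[zeta]
  * (rev_poly n (orthonormal_op mu n)).[zeta]
  / ((1 - gamma) * gamma^-1 + CD_kernel mu n zeta)%:C.

Definition exponentially_small (a : nat -> R[i]) : Prop :=
  exists C r : R, [/\ 0 < C, 0 < r, r < 1 &
    forall n, normc (a n) <= C * r ^+ n].

Definition bounded_var (a : nat -> R[i]) : Prop :=
  cvgn (series (fun n => normc (a n.+1 - a n))).

Lemma horner_rev_poly (n : nat) p (z : R[i]) : (size p <= n.+1)%N -> z != 0 ->
  (rev_poly n p).[z] = z ^+ n * conjc p.[(conjc z)^-1].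
Proof.
move=> sp z0; rewrite (horner_coef_wide _ sp) horner_poly rmorph_sum mulr_sumr.
rewrite (reindex_inj rev_ord_inj) /=; apply: eq_bigr => i _.
have hi : (i <= n)%N by rewrite -ltnS.
rewrite subSS subKn // rmorphM rmorphXn fmorphV /= conjcK exprVn.
rewrite mulrCA; congr (_ * _).
by rewrite expfB_cond ?(negPf z0) //= ?add0n.
Qed.

(* The library's sqrtc is the principal square root. *)
Lemma Re_sqrtc_gt0 (z : R[i]) :
  (0 < complex.Re z) || (complex.Im z != 0) -> 0 < complex.Re (sqrtc z).
Proof.
case: z => a b /= h; rewrite sqrtr_gt0 divr_gt0 // -ltrBlDr sub0r.
have [a0|a0] := ltP 0 a.
  by rewrite (lt_le_trans _ (sqrtr_ge0 _)) // oppr_lt0.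
rewrite ltNge a0 /= in h.
have b2 : 0 < b ^+ 2 by rewrite lt_def sqrf_eq0 h sqr_ge0.
rewrite -[ltLHS]ger0_norm ?oppr_ge0 // -sqrtr_sqr ltr_sqrt.
  by rewrite sqrrN ltrDl.
by rewrite ltr_wpDl ?sqr_ge0.
Qed.

End OPUC.

(* Main.v *)
Require Import Defs.
From mathcomp Require Import all_boot all_order all_algebra.
From mathcomp Require Import all_classical all_reals all_analysis.
From mathcomp Require Import measurable_realfun complex.
From mathcomp Require Import ring lra.
Import Order.TTheory GRing.Theory Num.Theory.
Import numFieldNormedType.Exports.
Local Open Scope classical_set_scope.
Local Open Scope ring_scope.
Local Open Scope complex_scope.
Set Implicit Arguments.
Unset Strict Implicit.
Unset Printing Implicit Defensive.

(** Write [u n] and [v n] for the values at [zeta] of the orthonormal polynomial and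
    of its reversal; they have the same modulus since [zeta] is on the circle, and the
    Szego recursion is a linear recursion for the pair.  Its limiting transfer matrix
    has the eigenvalues [e (c + s)] and [e (c - s)] up to the common factor
    [1 / sqrt (1 - |L|^2)], where [e = c + i S = expi (theta / 2)] and
    [s = sqrt (|L|^2 - S^2)].  The point [zeta] lies in the gap exactly when [s] is
    real and positive, and as [1 - |L|^2 = c^2 - s^2] one eigenvalue is then of
    modulus larger than 1 and the other of modulus smaller than 1.

    Because of this hyperbolicity there is a dichotomy ([cone_dichotomy],
    [gap_alternative]): either the growing component of the pair eventually dominates,
    and then [v] is unbounded and the quotient [u n / v n] tends to the attracting
    fixed point of the limiting Moebius map of the circle, or it never does, and then
    [u] and [v] decay exponentially.  The mass of [zeta] decides: an atom bounds
    [|u n|] ([orthonormal_bounded_at_atom]), and without an atom the kernel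
    [K_n(zeta, zeta)] is unbounded ([kernel_unbounded_off_atom]).

    In the growing case put [r n = u n / v n] and let [x n] be the denominator of
    [Delta n] divided by [|v n|^2].  Then [Delta n = (conj (zeta r n) - alpha n) / x n].
    The map moving [r n] to [r n.+1] contracts near its attracting point, so the
    bounded variation of [alpha] passes to [r]; and [x n.+1 = 1 + x n * g n] with
    [g n = |v n|^2 / |v n.+1|^2] tending to [(c - s) / (c + s)], so it passes to [x]
    ([bv_cvg_affine]) and to [Delta] ([gap_Delta_cvg]).  The limits of [r] and [x]
    are explicit, which gives the formula for the limit of [Delta].

    The relation between the coefficients of the two measures
    ([verblunsky_point_mass]) comes from the kernel polynomial: adding a point mass
    changes the monic orthogonal polynomial by a multiple of [K_n(., zeta)], and the
    Verblunsky coefficients are read off from the values at 0. *)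

(** * Complex modulus and bounded Borel functions *)

Section Modulus.
Context {R : realType}.
Implicit Types (x y z : R[i]) (a : R).

(** Morphism rules in terms of [conjc] itself: simplifying the generic [rmorph] rules
    would also expose the two components of the argument. *)
Lemma conjcD x y : conjc (x + y) = conjc x + conjc y.
Proof. exact: rmorphD. Qed.

Lemma conjcN x : conjc (- x) = - conjc x.
Proof. exact: rmorphN. Qed.

Lemma conjcB x y : conjc (x - y) = conjc x - conjc y.
Proof. exact: rmorphB. Qed.

Lemma conjcM x y : conjc (x * y) = conjc x * conjc y.
Proof. exact: rmorphM. Qed.

Lemma conjcV x : conjc x^-1 = (conjc x)^-1.
Proof. exact: fmorphV. Qed.

Lemma conjcX x n : conjc (x ^+ n) = conjc x ^+ n.
Proof. exact: rmorphXn. Qed.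

Lemma normc_ge0 z : 0 <= normc z.
Proof. by case: z => x y; exact: sqrtr_ge0. Qed.

Lemma normr_normc z : `|z| = (normc z)%:C.
Proof. by rewrite normc_def; case: z. Qed.

Lemma normc_realC a : normc a%:C = `|a|.
Proof. by rewrite /normc /= expr0n /= addr0 sqrtr_sqr. Qed.

Lemma normc_conj z : normc (conjc z) = normc z.
Proof. by case: z => x y /=; rewrite sqrrN. Qed.

Lemma realC_eq0 a : (a%:C == 0) = (a == 0).
Proof. exact: fmorph_eq0. Qed.

Lemma sqr_normcE z : ((normc z) ^+ 2)%:C = conjc z * z.
Proof. by rewrite rmorphXn /= -normr_normc sqr_normc mulrC. Qed.

Lemma sqr_normc_ReIm z :
  (normc z) ^+ 2 = (complex.Re z) ^+ 2 + (complex.Im z) ^+ 2.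
Proof. by case: z => x y /=; rewrite sqr_sqrtr // addr_ge0 ?sqr_ge0. Qed.

Lemma normc_eq0 z : (normc z == 0) = (z == 0).
Proof.
apply/eqP/eqP => [/eq0_normc //|->]; exact: normc0.
Qed.

Lemma normc_gt0 z : (0 < normc z) = (z != 0).
Proof. by rewrite lt_def normc_ge0 normc_eq0 andbT. Qed.

Lemma normcX z n : normc (z ^+ n) = normc z ^+ n.
Proof.
by elim: n => [|n ih]; rewrite ?expr0 ?normc1 // !exprS normcM ih.
Qed.

Lemma normcB x y : normc (x - y) = normc (y - x).
Proof. by rewrite -opprB normcN. Qed.

Lemma le_normcB x y : normc (x - y) <= normc x + normc y.
Proof. by rewrite -[normc y]normcN le_normcD. Qed.

Lemma lerB_normc x y : normc x - normc y <= normc (x - y).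
Proof. by rewrite lerBlDr -[X in normc X <= _](subrK y) le_normcD. Qed.

Lemma le_dist_normc x y z :
  normc (x - z) <= normc (x - y) + normc (y - z).
Proof. by rewrite -[X in normc X <= _](subrKA y) le_normcD. Qed.

Lemma Re_le_normc z : `|complex.Re z| <= normc z.
Proof.
by rewrite -lecR -normr_normc normc_ge_Re.
Qed.

Lemma Im_le_normc z : `|complex.Im z| <= normc z.
Proof.
case: z => x y /=; rewrite -sqrtr_sqr ler_wsqrtr //.
by rewrite lerDr sqr_ge0.
Qed.

Lemma circle_conjV z : normc z = 1 -> z^-1 = conjc z.
Proof.
move=> z1; have zz : conjc z * z = 1 by rewrite -sqr_normcE z1 expr1n.
have z0 : z != 0 by rewrite -normc_eq0 z1 oner_eq0.
by apply: (mulIf z0); rewrite mulVf.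
Qed.

Lemma circle_mul_conj z : normc z = 1 -> z * conjc z = 1.
Proof. by move=> z1; rewrite mulrC -sqr_normcE z1 expr1n. Qed.

Lemma normc_expi a : normc (expi a) = 1.
Proof. by rewrite /expi /= cos2Dsin2 sqrtr1. Qed.

End Modulus.

Section BorelFunctions.
Context {R : realType}.
Local Notation B := (borelC R).
Implicit Types (f g : R[i] -> R[i]) (p q : {poly R[i]}).

Lemma open_borelC (U : set R[i]^o) : open U -> measurable (U : set B).
Proof. by move=> oU; exact: sub_sigma_algebra. Qed.

Lemma measurable_lipschitz (F : R[i] -> R) :
  (forall z w, `|F z - F w| <= normc (z - w)) ->
  measurable_fun setT (F : B -> R).
Proof.
move=> lipF mT; apply: (measurability _ (RGenOpens.measurableE R)) => //.
move=> _ [_ [a [b ->]] <-]; rewrite setTI.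
apply: open_borelC; rewrite openE => z /= zab.
have [e e0 eP] : exists2 e : R, 0 < e & forall y, `|F z - y| < e -> y \in `]a, b[.
  have : nbhs (F z) `]a, b[%classic.
    by apply: open_nbhs_nbhs; split; [exact: interval_open|].
  rewrite -nbhs_ballE => -[e /= e0 eP]; exists e; first exact: e0.
  by move=> y Fzy; apply: eP; rewrite -ball_normE.
rewrite /interior -nbhs_ballE; exists e%:C; first by rewrite /= ltcR.
move=> w; rewrite -ball_normE /= normr_normc ltcR => zw.
by apply: eP; exact: le_lt_trans (lipF z w) zw.
Qed.

Lemma measurable_Re : measurable_fun setT (@complex.Re R : B -> R).
Proof.
apply: measurable_lipschitz => z w.
by rewrite -raddfB Re_le_normc.
Qed.

Lemma measurable_Im : measurable_fun setT (@complex.Im R : B -> R).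
Proof.
apply: measurable_lipschitz => z w.
by rewrite -raddfB Im_le_normc.
Qed.

Lemma measurable_normc : measurable_fun setT (@normc R : B -> R).
Proof.
apply: measurable_lipschitz => z w; rewrite ler_norml.
rewrite lerB_normc andbT lerNl opprB normcB; exact: lerB_normc.
Qed.

Lemma measurable_circle : measurable (@unit_circle R : set B).
Proof.
have -> : (@unit_circle R : set B) = (@normc R : B -> R) @^-1` [set 1] by [].
rewrite -[_ @^-1` _]setTI; exact: measurable_normc.
Qed.

Lemma measurable_point (z : R[i]) : measurable ([set z] : set B).
Proof.
have -> : ([set z] : set B) =
    (@complex.Re R : B -> R) @^-1` [set complex.Re z]
    `&` (@complex.Im R : B -> R) @^-1` [set complex.Im z].
  apply/seteqP; split => [w /= -> //|[a b] /= [-> ->]]; by case: z.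
apply: measurableI; rewrite -[_ @^-1` _]setTI.
- exact: measurable_Re.
- exact: measurable_Im.
Qed.

(** The functions that the circle integral treats linearly: they form an algebra closed
    under conjugation that contains the polynomials. *)
Definition bounded_borel f : Prop :=
  [/\ measurable_fun setT (@complex.Re R \o f : B -> R),
      measurable_fun setT (@complex.Im R \o f : B -> R) &
      exists M, forall z, unit_circle z -> normc (f z) <= M].

Lemma bounded_borel_cst (c : R[i]) : bounded_borel (fun=> c).
Proof. by split; [exact: measurable_cst|exact: measurable_cst|exists (normc c)]. Qed.

Lemma bounded_borel_id : bounded_borel id.
Proof.
split; [exact: measurable_Re|exact: measurable_Im|exists 1 => z].
by rewrite /unit_circle /= => ->.
Qed.

Lemma bounded_borelD f g : bounded_borel f -> bounded_borel g ->
  bounded_borel (fun z => f z + g z).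
Proof.
move=> [mf1 mf2 [M Mf]] [mg1 mg2 [N Ng]]; split.
- rewrite (_ : _ \o _ = (@complex.Re R \o f) \+ (@complex.Re R \o g)).
    exact: measurable_funD.
  by apply/funext => z /=; rewrite raddfD.
- rewrite (_ : _ \o _ = (@complex.Im R \o f) \+ (@complex.Im R \o g)).
    exact: measurable_funD.
  by apply/funext => z /=; rewrite raddfD.
- exists (M + N) => z z1; apply: le_trans (le_normcD _ _) _.
  by rewrite lerD ?Mf ?Ng.
Qed.

Lemma bounded_borelM f g : bounded_borel f -> bounded_borel g ->
  bounded_borel (fun z => f z * g z).
Proof.
move=> [mf1 mf2 [M Mf]] [mg1 mg2 [N Ng]]; split.
- rewrite (_ : _ \o _ = (@complex.Re R \o f) \* (@complex.Re R \o g)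
     \- (@complex.Im R \o f) \* (@complex.Im R \o g)).
    by apply: measurable_funB; exact: measurable_funM.
  by apply/funext => z /=; case: (f z) (g z) => [a b] [c d].
- rewrite (_ : _ \o _ = (@complex.Re R \o f) \* (@complex.Im R \o g)
     \+ (@complex.Im R \o f) \* (@complex.Re R \o g)).
    by apply: measurable_funD; exact: measurable_funM.
  by apply/funext => z /=; case: (f z) (g z) => [a b] [c d].
- exists (M * N) => z z1; rewrite normcM.
  by rewrite ler_pM ?normc_ge0 ?Mf ?Ng.
Qed.

Lemma bounded_borel_conj f : bounded_borel f ->
  bounded_borel (fun z => conjc (f z)).
Proof.
move=> [mf1 mf2 [M Mf]]; split.
- rewrite (_ : _ \o _ = @complex.Re R \o f) //.
  by apply/funext => z /=; case: (f z).
- rewrite (_ : _ \o _ = \- (@complex.Im R \o f)); first exact: measurable_funN.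
  by apply/funext => z /=; case: (f z).
- by exists M => z /Mf; rewrite normc_conj.
Qed.

Lemma bounded_borel_poly p : bounded_borel (fun z => p.[z]).
Proof.
elim/poly_ind: p => [|p c ih].
  rewrite (_ : (fun z => _) = fun=> 0); first exact: bounded_borel_cst.
  by apply/funext => z; rewrite horner0.
rewrite (_ : (fun z => _) = fun z => p.[z] * z + c).
  apply: bounded_borelD (bounded_borel_cst _).
  exact: bounded_borelM bounded_borel_id.
by apply/funext => z; rewrite hornerMXaddC.
Qed.

Lemma bounded_borel_inner p q : bounded_borel (fun z => conjc p.[z] * q.[z]).
Proof.
apply: bounded_borelM (bounded_borel_poly q).
exact: bounded_borel_conj (bounded_borel_poly p).
Qed.

End BorelFunctions.

(** * The circle integral and the inner product *)

Section CircleIntegral.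
Context {R : realType}.
Local Notation B := (borelC R).
Variable mu : probability B R.
Implicit Types (f g : R[i] -> R[i]) (p q : {poly R[i]}).

Lemma circle_finite : (mu (@unit_circle R : set B) < +oo)%E.
Proof.
apply: le_lt_trans (ltry 1).
by apply: probability_le1; exact: measurable_circle.
Qed.

Lemma integrable_real_circle (F : B -> R) (M : R) : measurable_fun setT F ->
  (forall z, unit_circle z -> `|F z| <= M) ->
  mu.-integrable (@unit_circle R : set B) (EFin \o F).
Proof.
move=> mF FM; apply: measurable_bounded_integrable.
- exact: measurable_circle.
- exact: circle_finite.
- exact: measurable_funS mF.
- exists M; split => [|N MN z /FM zM]; first exact: num_real.
  exact: le_trans zM (ltW MN).
Qed.

Lemma bounded_borel_integrable f : bounded_borel f ->
  mu.-integrable (@unit_circle R : set B) (EFin \o (@complex.Re R \o f : B -> R))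
  /\ mu.-integrable (@unit_circle R : set B) (EFin \o (@complex.Im R \o f : B -> R)).
Proof.
move=> [mf1 mf2 [M Mf]]; split; apply: integrable_real_circle => // z /Mf.
- by apply: le_trans; exact: Re_le_normc.
- by apply: le_trans; exact: Im_le_normc.
Qed.

Lemma eq_circle_integral f g : (forall z, unit_circle z -> f z = g z) ->
  circle_integral mu f = circle_integral mu g.
Proof.
move=> fg; rewrite /circle_integral; congr (_ +i* _).
- by apply: eq_Rintegral => z /set_mem /fg ->.
- by apply: eq_Rintegral => z /set_mem /fg ->.
Qed.

Lemma circle_integralD f g : bounded_borel f -> bounded_borel g ->
  circle_integral mu (fun z => f z + g z) =
  circle_integral mu f + circle_integral mu g.
Proof.
move=> /bounded_borel_integrable[f1 f2] /bounded_borel_integrable[g1 g2].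
have mC : measurable (@unit_circle R : set B) by exact: measurable_circle.
have hR := RintegralD mC f1 g1.
have hI := RintegralD mC f2 g2.
rewrite /circle_integral; simpc; congr (_ +i* _).
- by rewrite -hR; apply: eq_Rintegral => z _; rewrite raddfD.
- by rewrite -hI; apply: eq_Rintegral => z _; rewrite raddfD.
Qed.

Lemma circle_integralZ (c : R[i]) f : bounded_borel f ->
  circle_integral mu (fun z => c * f z) = c * circle_integral mu f.
Proof.
move=> /bounded_borel_integrable[f1 f2].
have mC : measurable (@unit_circle R : set B) by exact: measurable_circle.
case: c => a b.
have iZ (F : B -> R) (r : R) :
    mu.-integrable (@unit_circle R : set B) (EFin \o F) ->
    mu.-integrable (@unit_circle R : set B) (EFin \o (fun x => r * F x)).
  by move=> iF; exact: (integrableZl mC r iF).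
have hR := RintegralB mC (iZ _ a f1) (iZ _ b f2).
have hI := RintegralD mC (iZ _ a f2) (iZ _ b f1).
rewrite /circle_integral; simpc.
rewrite -(RintegralZl a mC f1) -(RintegralZl b mC f2) -hR.
rewrite -(RintegralZl a mC f2) -(RintegralZl b mC f1) -hI.
congr (_ +i* _); apply: eq_Rintegral => z _ /=; case: (f z) => x y //=.
Qed.

Lemma circle_integral_conj f : bounded_borel f ->
  circle_integral mu (fun z => conjc (f z)) = conjc (circle_integral mu f).
Proof.
move=> /bounded_borel_integrable[f1 f2].
have mC : measurable (@unit_circle R : set B) by exact: measurable_circle.
rewrite /circle_integral; simpc; congr (_ +i* _).
  by apply: eq_Rintegral => z _; case: (f z).
rewrite -mulN1r -(RintegralZl (-1) mC f2).
by apply: eq_Rintegral => z _ /=; rewrite mulN1r; case: (f z).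
Qed.

Lemma innerDr p q1 q2 : inner mu p (q1 + q2) = inner mu p q1 + inner mu p q2.
Proof.
rewrite /inner -circle_integralD; [|exact: bounded_borel_inner..].
by apply: eq_circle_integral => z _; rewrite hornerD mulrDr.
Qed.

Lemma innerZr p c q : inner mu p (c *: q) = c * inner mu p q.
Proof.
rewrite /inner -circle_integralZ; last exact: bounded_borel_inner.
by apply: eq_circle_integral => z _; rewrite hornerZ mulrCA.
Qed.

Lemma inner_conj p q : inner mu p q = conjc (inner mu q p).
Proof.
rewrite /inner -circle_integral_conj; last exact: bounded_borel_inner.
by apply: eq_circle_integral => z _; rewrite conjcM conjcK mulrC.
Qed.

Lemma innerDl p1 p2 q : inner mu (p1 + p2) q = inner mu p1 q + inner mu p2 q.
Proof. by rewrite inner_conj innerDr conjcD -!inner_conj. Qed.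

Lemma innerZl c p q : inner mu (c *: p) q = conjc c * inner mu p q.
Proof. by rewrite inner_conj innerZr conjcM -inner_conj. Qed.

Lemma innerNr p q : inner mu p (- q) = - inner mu p q.
Proof. by rewrite -scaleN1r innerZr mulN1r. Qed.

Lemma innerBr p q1 q2 : inner mu p (q1 - q2) = inner mu p q1 - inner mu p q2.
Proof. by rewrite innerDr innerNr. Qed.

Lemma innerBl p1 p2 q : inner mu (p1 - p2) q = inner mu p1 q - inner mu p2 q.
Proof. by rewrite inner_conj innerBr conjcB -!inner_conj. Qed.

Lemma inner0r p : inner mu p 0 = 0.
Proof. by rewrite -(scale0r 0) innerZr mul0r. Qed.

(** Multiplication by the variable is unitary because [|z| = 1] on the circle. *)
Lemma innerXX p q : inner mu ('X * p) ('X * q) = inner mu p q.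
Proof.
apply: eq_circle_integral => z z1.
rewrite !hornerM !hornerX conjcM mulrACA -sqr_normcE.
by rewrite z1 expr1n mul1r.
Qed.

(** On the circle the reversed polynomial is [z^n] times the conjugate, so reversal is
    antiunitary. *)
Lemma inner_rev n p q : (size p <= n.+1)%N -> (size q <= n.+1)%N ->
  inner mu (rev_poly n p) (rev_poly n q) = inner mu q p.
Proof.
move=> sp sq; apply: eq_circle_integral => z z1.
have z0 : z != 0 by rewrite -normc_eq0 z1 oner_eq0.
rewrite !horner_rev_poly // -(circle_conjV z1) invrK conjcM conjcK.
rewrite mulrACA -sqr_normcE normcX z1 !expr1n mul1r; exact: mulrC.
Qed.

(** The left side is defined through two real integrals; the imaginary one vanishes. *)
Lemma inner_norm2 p : inner mu p p = ((norm2 mu p) ^+ 2)%:C.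
Proof.
rewrite /norm2 sqr_sqrtr; last by apply: Rintegral_ge0 => z _; exact: sqr_ge0.
rewrite /inner /circle_integral; congr (_ +i* _).
  by apply: eq_Rintegral => z _; rewrite -sqr_normcE.
rewrite (_ : Rintegral _ _ _ =
   \int[mu]_(z in (@unit_circle R : set B)) (cst 0 z : R)).
  by rewrite Rintegral_cst ?mul0r //; exact: measurable_circle.
by apply: eq_Rintegral => z _; rewrite -sqr_normcE.
Qed.

Lemma norm2_ge0 p : 0 <= norm2 mu p.
Proof. exact: sqrtr_ge0. Qed.

Lemma measurable_sqr_normc_poly p :
  measurable_fun setT ((fun z => (normc p.[z]) ^+ 2) : B -> R).
Proof.
have [m1 m2 _] := bounded_borel_poly p.
rewrite (_ : (fun z => _) = (fun z => (@complex.Re R \o (fun z => p.[z])) z ^+ 2)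
   \+ (fun z => (@complex.Im R \o (fun z => p.[z])) z ^+ 2)).
  by apply: measurable_funD; exact: measurable_funX.
by apply/funext => z /=; rewrite sqr_normc_ReIm.
Qed.

Lemma integrable_sqr_normc_poly p :
  mu.-integrable (@unit_circle R : set B)
    (EFin \o (fun z => (normc p.[z]) ^+ 2)).
Proof.
have [_ _ [M Mf]] := bounded_borel_poly p.
apply: (@integrable_real_circle _ (M ^+ 2)) => [|z z1].
  exact: measurable_sqr_normc_poly.
by rewrite ger0_norm ?sqr_ge0 // lerXn2r ?nnegrE ?normc_ge0 ?Mf //
  (le_trans _ (Mf _ z1)) ?normc_ge0.
Qed.

Lemma norm2_sqrE p :
  ((norm2 mu p) ^+ 2)%:E =
  (\int[mu]_(z in (@unit_circle R : set B)) ((normc p.[z]) ^+ 2)%:E)%E.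
Proof.
rewrite /norm2 sqr_sqrtr; last by apply: Rintegral_ge0 => z _; exact: sqr_ge0.
rewrite /Rintegral fineK //; apply: integrable_fin_num.
  exact: measurable_circle.
exact: integrable_sqr_normc_poly.
Qed.

Lemma norm2_atom p zeta : normc zeta = 1 ->
  (mu [set zeta] * ((normc p.[zeta]) ^+ 2)%:E <= ((norm2 mu p) ^+ 2)%:E)%E.
Proof.
move=> z1; rewrite norm2_sqrE muleC.
have mz : measurable ([set zeta] : set B) by exact: measurable_point.
rewrite -(integral_cst mu mz).
rewrite (eq_integral (fun z : B => ((normc p.[z : R[i]]) ^+ 2)%:E)); last first.
  by move=> z /set_mem ->.
apply: ge0_subset_integral => //.
- exact: measurable_circle.
- apply/measurable_EFinP; exact: measurable_funS (measurable_sqr_normc_poly p).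
- by move=> z _; rewrite lee_fin sqr_ge0.
- by move=> z /= ->.
Qed.

End CircleIntegral.

(** * Positivity, peak polynomials and point masses *)

Section CircleMeasures.
Context {R : realType}.
Local Notation B := (borelC R).
Implicit Types (mu nu : probability B R) (p q : {poly R[i]}).

Lemma finite_roots p : p != 0 -> finite_set [set z | root p z].
Proof.
move=> p0; have [r pE] := closed_field_poly_normal p.
apply: (sub_finite_set _ (finite_seq r)) => z /=.
by rewrite pE rootZ ?lead_coef_eq0 // root_prod_XsubC.
Qed.

(** If the norm vanishes, the measure lives on the zeros of [p] on the circle; the
    complement of the zeros is open, so the support is contained in a finite set. *)
Lemma norm2_gt0 mu p : mu unit_circle = 1%E -> infinite_set (msupport mu) ->
  p != 0 -> 0 < norm2 mu p.
Proof.
move=> mu1 muinf p0; rewrite lt_def norm2_ge0 andbT; apply/eqP => Np.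
apply: muinf; apply: (sub_finite_set _ (finite_roots p0)) => z /= zsupp.
apply: contrapT => /negP pz.
pose U : set R[i]^o := ~` [set z | root p z].
have oU : open U.
  apply: closed_openC; move: (finite_roots p0).
  exact: (accessible_finite_set_closed.1
    (hausdorff_accessible (@norm_hausdorff _ R[i]^o))).
have mC : measurable (@unit_circle R : set B) by exact: measurable_circle.
have := zsupp _ oU; rewrite /U /= => /(_ (elimN idP pz)); rewrite ltNge => /negP; apply.
have mF : measurable_fun (@unit_circle R : set B)
    (EFin \o (fun z => (normc p.[z]) ^+ 2)).
  by apply/measurable_EFinP; exact: measurable_funS (measurable_sqr_normc_poly p).
have := norm2_sqrE mu p; rewrite Np expr0n /= => /esym i0.
have : (\int[mu]_(z in (@unit_circle R : set B))
    `|(EFin \o (fun z => (normc p.[z]) ^+ 2)%R) z| = 0)%E.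
  rewrite -[RHS]i0; apply: eq_integral => w _ /=.
  by rewrite ger0_norm ?sqr_ge0.
move=> /(ae_eq_integral_abs mu mC mF)[N [mN N0 subN]].
have mCc : measurable (~` (@unit_circle R : set B)) by exact: measurableC.
have sub : (U : set B) `<=` N `|` ~` (@unit_circle R : set B).
  move=> w Uw; have [w1|w1] := pselect (unit_circle w); last by right.
  left; apply: subN => /= /(_ w1) [] /eqP.
  by rewrite sqrf_eq0 normc_eq0 => pw; exact: Uw.
apply: le_trans (le_measure mu _ _ sub) _; rewrite ?inE //.
- exact: open_borelC.
- exact: measurableU.
apply: le_trans (measureU2 _ _ _) _ => //.
have mu0 : mu (~` (@unit_circle R : set B)) = 0%E.
  apply: etrans (probability_setC mu mC) _; by rewrite [mu _]mu1 subee.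
have : (mu N + mu (~` (@unit_circle R : set B)) <= 0)%E by rewrite N0 mu0 adde0.
exact.
Qed.

Lemma eval_le_norm2_atom mu p zeta : normc zeta = 1 -> (0 < mu [set zeta])%E ->
  normc p.[zeta] <= norm2 mu p / Num.sqrt (fine (mu [set zeta])).
Proof.
move=> z1 m0; have := norm2_atom mu p z1.
have fm : mu [set zeta] \is a fin_num.
  by apply: fin_num_measure; exact: measurable_point.
rewrite -(fineK fm) -EFinM lee_fin => le.
have m0' : 0 < fine (mu [set zeta]) by rewrite fine_gt0 // m0 ltey_eq fm.
rewrite ler_pdivlMr ?sqrtr_gt0 //.
rewrite -(@ler_pXn2r _ 2) ?nnegrE ?mulr_ge0 ?sqrtr_ge0 ?normc_ge0 ?norm2_ge0 //.
rewrite exprMn sqr_sqrtr; last exact: ltW.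
by rewrite mulrC.
Qed.

(** Polynomials equal to 1 at [zeta] and tending to 0 pointwise on the rest of the
    circle, where [|1 + conj zeta * z| < 2]. *)
Definition peak (zeta : R[i]) (m : nat) : {poly R[i]} :=
  ((2%:R)^-1 *: (1 + conjc zeta *: 'X)) ^+ m.

Lemma peak_zeta zeta m : normc zeta = 1 -> (peak zeta m).[zeta] = 1.
Proof.
move=> z1; rewrite /peak horner_exp hornerZ hornerD hornerZ hornerX hornerC.
by rewrite mulrC [_ * zeta]mulrC circle_mul_conj // divff ?expr1n // pnatr_eq0.
Qed.

Lemma normc_half1D (w : R[i]) : normc w = 1 -> w != 1 ->
  normc ((2%:R)^-1 * (1 + w)) < 1.
Proof.
case: w => a b w1 wn1.
rewrite -(@ltr_pXn2r _ 2) ?nnegrE ?normc_ge0 // expr1n.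
have ab : a ^+ 2 + b ^+ 2 = 1 by rewrite -(sqr_normc_ReIm (a +i* b)) w1 expr1n.
have a1 : a < 1.
  rewrite ltNge; apply/negP => a1; case/eqP: wn1.
  have b0 : b = 0.
    apply/eqP; rewrite -sqrf_eq0 eq_le sqr_ge0 andbT.
    have : 1 <= a ^+ 2 by rewrite -[1](expr1n _ 2) lerXn2r ?nnegrE // (le_trans _ a1).
    by move: ab; lra.
  move: ab; rewrite b0 expr0n /= addr0 => /eqP; rewrite sqrf_eq1.
  case/orP => /eqP aE; last by exfalso; move: a1; rewrite aE; lra.
  by rewrite aE.
rewrite normcM exprMn normcV.
rewrite (_ : (2%:R : R[i]) = (2%:R : R)%:C); last by rewrite rmorph_nat.
rewrite normc_realC ger0_norm // sqr_normc_ReIm /=.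
by move: ab a1; lra.
Qed.

(** Dominated convergence: the squared norms tend to the mass of [zeta]. *)
Lemma norm2_peak_small mu zeta e : normc zeta = 1 -> mu [set zeta] = 0%E ->
  0 < e -> exists m, (norm2 mu (peak zeta m)) ^+ 2 < e.
Proof.
move=> z1 mz e0.
have mC : measurable (@unit_circle R : set B) by exact: measurable_circle.
have mZ : measurable ([set zeta] : set B) by exact: measurable_point.
pose f m : B -> \bar R := EFin \o (fun z => (normc (peak zeta m).[z]) ^+ 2).
pose g : B -> \bar R := EFin \o (\1_([set zeta] : set B) : B -> R).
have [] := @dominated_convergence _ _ _ mu _ mC f g (EFin \o cst 1).
- move=> m; apply/measurable_EFinP.
  exact: measurable_funS (measurable_sqr_normc_poly _).
- by apply/measurable_EFinP; exact: measurable_indic.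
- apply: aeW => z z1'; rewrite /g /f /=.
  apply: cvg_EFin; first by near=> m.
  rewrite /comp /=.
  have [zz|zz] := eqVneq (z : R[i]) zeta.
    rewrite indicE mem_set //; under eq_fun do rewrite zz peak_zeta // normc1 expr1n.
    exact: cvg_cst.
  rewrite indicE memNset; last by move=> /= ez; rewrite ez eqxx in zz.
  pose t := normc ((2%:R)^-1 * (1 + conjc zeta * (z : R[i]))).
  have t1 : t ^+ 2 < 1.
    rewrite -[ltRHS](expr1n _ 2) ltr_pXn2r ?nnegrE ?normc_ge0 //.
    apply: normc_half1D; first by rewrite normcM normc_conj z1 z1' mulr1.
    apply/eqP => /(congr1 (fun w => zeta * w)).
    by rewrite mulrA circle_mul_conj // mul1r mulr1 => /eqP; rewrite (negPf zz).
  rewrite [X in X @ _ --> _](_ : _ = (fun m => (t ^+ 2) ^+ m)).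
    by apply: cvg_expr; rewrite ger0_norm ?sqr_ge0.
  apply/funext => m; rewrite /peak horner_exp hornerZ hornerD hornerZ hornerX hornerC.
  by rewrite normcX -!exprM mulnC.
- exact: finite_measure_integrable_cst.
- apply: aeW => z m z1' /=; rewrite lee_fin ger0_norm ?sqr_ge0 //.
  rewrite /peak horner_exp normcX -exprM exprn_ile1 ?normc_ge0 //.
  rewrite hornerZ hornerD hornerZ hornerX hornerC.
  have [w1|w1] := eqVneq (conjc zeta * z) 1.
    rewrite w1 (_ : 1 + 1 = 2%:R) // mulVf ?pnatr_eq0 // normc1 //.
  by apply/ltW/normc_half1D => //; rewrite normcM normc_conj z1 z1' mulr1.
have gI : (\int[mu]_(z in (@unit_circle R : set B)) g z = 0)%E.
  rewrite /g integral_indic // (_ : _ `&` _ = [set zeta]); first exact: mz.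
  by apply/seteqP; split => [z []|z /= ->].
move=> _ _; rewrite gI => fcvg.
have {fcvg} : (fun m => (norm2 mu (peak zeta m) ^+ 2)%:E) @ \oo --> 0%:E.
  by apply: cvg_trans fcvg; apply: near_eq_cvg; near=> m; rewrite norm2_sqrE.
move=> /fine_cvgP[_ /cvgrPdist_lt/(_ _ e0)[m _ mP]].
exists m; have := mP m (leqnn m); rewrite /= sub0r normrN ger0_norm ?sqr_ge0 //.
Unshelve. all: by end_near. Qed.

Section PointMass.
Variables (mu nu : probability B R) (zeta : R[i]) (gamma : R).
Hypothesis zeta1 : normc zeta = 1.
Hypothesis gamma01 : 0 < gamma < 1.
Hypothesis nuE : forall A : set B, measurable A ->
  nu A = ((1 - gamma)%:E * mu A + gamma%:E * \d_(zeta : B) A)%E.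

Let gamma0 : 0 <= gamma. Proof. by case/andP: gamma01 => /ltW. Qed.
Let gamma1 : 0 <= 1 - gamma. Proof. by case/andP: gamma01 => _ /ltW; rewrite subr_ge0. Qed.

(** The integral is linear in the measure on nonnegative functions; the general bounded
    case follows by adding a constant. *)
Lemma integral_point_mass_ge0 (F : B -> R) (M : R) : measurable_fun setT F ->
  (forall z, unit_circle z -> 0 <= F z <= M) ->
  \int[nu]_(z in (@unit_circle R : set B)) F z =
  (1 - gamma) * \int[mu]_(z in (@unit_circle R : set B)) F z + gamma * F zeta.
Proof.
move=> mF FM.
have mC : measurable (@unit_circle R : set B) by exact: measurable_circle.
have mFC : measurable_fun (@unit_circle R : set B) (EFin \o F).
  by apply/measurable_EFinP; exact: measurable_funS mF.
have F0 z : (@unit_circle R : set B) z -> (0 <= (EFin \o F) z)%E.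
  by move=> /FM/andP[+ _]; rewrite lee_fin.
have iF : mu.-integrable (@unit_circle R : set B) (EFin \o F).
  apply: (@integrable_real_circle _ mu _ M) => // z /FM/andP[? ?].
  by rewrite ger0_norm.
rewrite /Rintegral.
rewrite (@eq_measure_integral _ _ _ _ (measure_add (mscale (NngNum gamma1) mu)
   (mscale (NngNum gamma0) (\d_(zeta : B))))); last first.
  move=> A mA _; apply: etrans (nuE mA) (esym _).
  exact: measure_addE.
rewrite ge0_integral_measure_add // !ge0_integral_mscale //.
rewrite integral_dirac // diracE mem_set //= mul1e.
by rewrite -(fineK (integrable_fin_num mC iF)) -!EFinM -EFinD.
Qed.

Lemma integral_point_mass (F : B -> R) (M : R) : measurable_fun setT F ->
  (forall z, unit_circle z -> `|F z| <= M) ->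
  \int[nu]_(z in (@unit_circle R : set B)) F z =
  (1 - gamma) * \int[mu]_(z in (@unit_circle R : set B)) F z + gamma * F zeta.
Proof.
move=> mF FM.
have mC : measurable (@unit_circle R : set B) by exact: measurable_circle.
have M0 : 0 <= M by apply: le_trans (FM _ zeta1).
have m1 : measurable_fun setT (F \+ cst M) by exact: measurable_funD.
have iM (m : probability B R) :
    m.-integrable (@unit_circle R : set B) (EFin \o cst M).
  exact: finite_measure_integrable_cst.
have iF (m : probability B R) :
    m.-integrable (@unit_circle R : set B) (EFin \o F).
  exact: (@integrable_real_circle _ m F M mF FM).
have h1 : _ := @integral_point_mass_ge0 (F \+ cst M) (M + M) m1 _.
have h2 : _ := @integral_point_mass_ge0 (cst M) M (measurable_cst _) _.
move: h1 h2; rewrite /= !(RintegralD mC (iF _) (iM _)) => h1 h2.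
have /h1{h1} : forall z : R[i], unit_circle z -> 0 <= F z + M <= M + M.
  by move=> z /FM; rewrite ler_norml; lra.
have /h2{h2} : forall z : R[i], unit_circle z -> 0 <= M <= M.
  by rewrite M0 lexx.
by move=> /=; lra.
Qed.

Lemma inner_point_mass p q : inner nu p q =
  (1 - gamma)%:C * inner mu p q + gamma%:C * (conjc p.[zeta] * q.[zeta]).
Proof.
have [m1 m2 [M FM]] := bounded_borel_inner p q.
have h1 := integral_point_mass m1 (fun z z1 => le_trans (Re_le_normc _) (FM z z1)).
have h2 := integral_point_mass m2 (fun z z1 => le_trans (Im_le_normc _) (FM z z1)).
rewrite /inner /circle_integral; move: h1 h2 => /= -> ->.
case: (conjc _ * _) => x y /=; simpc; congr (_ +i* _); ring.
Qed.

Lemma circle_point_mass : mu unit_circle = 1%E -> nu unit_circle = 1%E.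
Proof.
move=> mu1; apply: etrans (nuE measurable_circle) _.
rewrite [mu _]mu1 diracE mem_set // !mule1 -EFinD; congr _%:E; ring.
Qed.

Lemma msupport_point_mass : msupport mu `<=` msupport nu.
Proof.
move=> z zmu U oU Uz; have U0 := zmu U oU Uz.
suff : (0 < (1 - gamma)%:E * mu (U : set B) + gamma%:E * \d_(zeta : B) (U : set B))%E.
  by rewrite -nuE //; exact: open_borelC.
apply: lt_le_trans (leeDl _ _); last first.
  by rewrite mule_ge0 // lee_fin.
by rewrite mule_gt0 // lte_fin subr_gt0; case/andP: gamma01.
Qed.

End PointMass.
End CircleMeasures.

(** * Orthogonal polynomials and the Szego recursion *)

Section ReversedPolynomials.
Context {R : realType}.
Implicit Types (p q : {poly R[i]}).

Lemma coef_rev_poly n p i :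
  (rev_poly n p)`_i = if (i < n.+1)%N then conjc p`_(n - i) else 0.
Proof. exact: coef_poly. Qed.

Lemma size_rev_poly n p : (size (rev_poly n p) <= n.+1)%N.
Proof. exact: size_poly. Qed.

Lemma rev_polyK n p : (size p <= n.+1)%N -> rev_poly n (rev_poly n p) = p.
Proof.
move=> sp; apply/polyP => i; rewrite coef_rev_poly.
case: ltnP => ni; last by rewrite nth_default // (leq_trans sp).
by rewrite coef_rev_poly ltnS leq_subr conjcK subKn.
Qed.

Lemma rev_polyZ n c p : rev_poly n (c *: p) = conjc c *: rev_poly n p.
Proof.
apply/polyP => i; rewrite coefZ !coef_rev_poly coefZ conjcM.
by case: ifP; rewrite ?mulr0.
Qed.

Lemma rev_poly1 n : rev_poly n 1 = 'X^n :> {poly R[i]}.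
Proof.
apply/polyP => i; rewrite coef_rev_poly coefXn coef1 subn_eq0.
by case: (ltngtP i n) => [ni|ni|->]; rewrite ?ltnS ?(ltnW ni) ?leqnn ?conjc0 ?conjc1 //;
  rewrite leqNgt ni.
Qed.

Lemma size_rev_polyMX n q : (size q <= n)%N -> (size (rev_poly n ('X * q)%R) <= n)%N.
Proof.
move=> sq; apply/leq_sizeP => j nj; rewrite coef_rev_poly.
case: ltnP => // jn; have -> : j = n by apply/eqP; rewrite eqn_leq nj -ltnS jn.
by rewrite subnn coefXM conjc0.
Qed.

Lemma horner0_rev_poly n p : p \is monic -> size p = n.+1 -> (rev_poly n p).[0] = 1.
Proof.
move=> /monicP pm sp; rewrite horner_coef0 coef_rev_poly subn0 /=.
by rewrite -[n]/(n.+1.-1) -sp -lead_coefE pm conjc1.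
Qed.

(** On the unit circle [1 / conj z = z]. *)
Lemma horner_rev_poly_circle n p z : (size p <= n.+1)%N -> normc z = 1 ->
  (rev_poly n p).[z] = z ^+ n * conjc p.[z].
Proof.
move=> sp z1; have z0 : z != 0 by rewrite -normc_eq0 z1 oner_eq0.
by rewrite horner_rev_poly // -(circle_conjV z1) invrK.
Qed.

Lemma normc_rev_poly n p z : (size p <= n.+1)%N -> normc z = 1 ->
  normc (rev_poly n p).[z] = normc p.[z].
Proof.
move=> sp z1; rewrite horner_rev_poly_circle // normcM normcX z1 expr1n mul1r.
exact: normc_conj.
Qed.

End ReversedPolynomials.

Section MonicOrthogonal.
Context {R : realType}.
Variable mu : probability (borelC R) R.
Hypothesis mu_pos : forall p : {poly R[i]}, p != 0 -> 0 < norm2 mu p.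
Implicit Types (p q : {poly R[i]}).

Lemma inner_eq0 p : inner mu p p = 0 -> p = 0.
Proof.
move=> pp; apply/eqP; apply: contraT => /mu_pos; rewrite lt_def => /andP[/eqP []].
by apply/eqP; rewrite -sqrf_eq0 -(inj_eq (@complexI R)) -inner_norm2 pp.
Qed.

Lemma monic_orthogonal_uniq n p q : is_monic_orthogonal mu n p ->
  is_monic_orthogonal mu n q -> p = q.
Proof.
move=> [mp sp op] [mq sq oq]; apply/eqP; rewrite -subr_eq0; apply/eqP.
apply: inner_eq0; rewrite innerBr.
suff s : (size (p - q)%R <= n)%N by rewrite op // oq // subrr.
apply/leq_sizeP => j; rewrite leq_eqVlt coefB => /predU1P[<-|nj].
  move/monicP: mp; move/monicP: mq; rewrite !lead_coefE sp sq /= => -> ->.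
  by rewrite subrr.
by rewrite !nth_default ?subrr // ?sp ?sq.
Qed.

Lemma monic_orthogonal0 : is_monic_orthogonal mu 0 1.
Proof.
split; rewrite ?monic1 ?size_poly1 // => q.
by rewrite leqn0 size_poly_eq0 => /eqP ->; rewrite inner_conj inner0r conjc0.
Qed.

Lemma inner_one_rev n p : is_monic_orthogonal mu n p ->
  inner mu 1 (rev_poly n p) = ((norm2 mu p) ^+ 2)%:C.
Proof.
move=> [mp sp op].
rewrite -[X in inner mu X _](@rev_polyK _ n); last by rewrite size_poly1.
rewrite inner_rev ?sp ?size_rev_poly // rev_poly1 -(subrK p 'X^n) innerDr.
rewrite inner_conj op ?conjc0 ?add0r ?inner_norm2 //.
apply/leq_sizeP => j; rewrite leq_eqVlt coefB coefXn => /predU1P[<-|nj].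
  by move/monicP: mp; rewrite lead_coefE sp /= => ->; rewrite eqxx subrr.
by rewrite nth_default ?sp // gtn_eqF // subrr.
Qed.

(** Both [z Phi_n] and [Phi_n^*] are orthogonal to [z, ..., z^n]; the coefficient
    is chosen so that the combination is orthogonal to the constants too. *)
Lemma monic_orthogonalS n p : is_monic_orthogonal mu n p ->
  exists a, is_monic_orthogonal mu n.+1 ('X * p - conjc a *: rev_poly n p).
Proof.
move=> Hp; have [mp sp op] := Hp.
have p0 : p != 0 by rewrite monic_neq0.
pose a := conjc (inner mu 1 ('X * p) / ((norm2 mu p) ^+ 2)%:C); exists a.
have sXp : size ('X * p) = n.+2 by rewrite mulrC size_mulX // sp.
have slt : (size (- (conjc a *: rev_poly n p))%R < size ('X * p)%R)%N.
  rewrite sXp ltnS size_polyN; apply: leq_trans (size_scale_leq _ _) _.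
  exact: size_rev_poly.
split.
- by rewrite monicE lead_coefDl // lead_coefM lead_coefX mul1r -monicE.
- by rewrite size_polyDl.
- elim/poly_ind => [|q c _] sq; first by rewrite inner_conj inner0r conjc0.
  have sq' : (size q <= n)%N.
    move: sq; rewrite size_MXaddC; case: ifP => [/andP[/eqP -> _] _|_ //].
    by rewrite size_poly0.
  rewrite [q * 'X]mulrC innerDl.
  rewrite (_ : inner mu ('X * q) _ = 0); last first.
    rewrite innerBr innerXX op // innerZr.
    have sXq : (size ('X * q)%R <= n.+1)%N.
      have [->|q0] := eqVneq q 0; first by rewrite mulr0 size_poly0.
      by rewrite mulrC size_mulX.
    rewrite -[X in inner mu X (rev_poly _ _)](rev_polyK sXq) inner_rev ?sp //.
      rewrite inner_conj op ?conjc0 ?mulr0 ?subr0 //; exact: size_rev_polyMX.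
    exact: size_rev_poly.
  rewrite add0r -[c]mulr1 polyCM mul_polyC innerZl innerBr innerZr.
  rewrite inner_one_rev // /a conjcK divfK ?subrr ?mulr0 //.
  by rewrite realC_eq0 sqrf_eq0 gt_eqF // mu_pos.
Qed.

Lemma monic_opP n : is_monic_orthogonal mu n (monic_op mu n).
Proof.
suff [p Hp] : exists p, is_monic_orthogonal mu n p.
  exact: (@xgetPex _ 0 [set p | is_monic_orthogonal mu n p] (ex_intro _ p Hp)).
elim: n => [|n [p Hp]]; first by exists 1; exact: monic_orthogonal0.
by have [a Ha] := monic_orthogonalS Hp; exists ('X * p - conjc a *: rev_poly n p).
Qed.

Local Notation Phi := (monic_op mu).
Local Notation alpha := (verblunsky mu).
Local Notation N n := (norm2 mu (Phi n)).

Lemma monic_op_monic n : Phi n \is monic.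
Proof. by case: (monic_opP n). Qed.

Lemma size_monic_op n : size (Phi n) = n.+1.
Proof. by case: (monic_opP n). Qed.

Lemma inner_monic_op n q : (size q <= n)%N -> inner mu q (Phi n) = 0.
Proof. by case: (monic_opP n) => _ _; exact. Qed.

Lemma norm2_monic_gt0 n : 0 < N n.
Proof. by apply: mu_pos; rewrite monic_neq0 // monic_op_monic. Qed.

Lemma szego_recursion n :
  Phi n.+1 = 'X * Phi n - conjc (alpha n) *: rev_poly n (Phi n).
Proof.
have [a Ha] := monic_orthogonalS (monic_opP n).
have := monic_orthogonal_uniq (monic_opP n.+1) Ha.
exact: (@xgetPex _ 0 [set a | Phi n.+1 = 'X * Phi n - conjc a *: rev_poly n (Phi n)]
  \o ex_intro _ a).
Qed.

Lemma horner0_monic_opS n : (Phi n.+1).[0] = - conjc (alpha n).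
Proof.
rewrite szego_recursion hornerD hornerN hornerM hornerX mul0r hornerZ.
by rewrite horner0_rev_poly ?monic_op_monic ?size_monic_op // mulr1 add0r.
Qed.

(** Pythagoras: [z Phi_n] is the sum of [Phi_n.+1] and of a multiple of the reversed
    polynomial, which has lower degree and hence is orthogonal to [Phi_n.+1]. *)
Lemma norm2_monic_opS n :
  N n.+1 ^+ 2 = (1 - (normc (alpha n)) ^+ 2) * N n ^+ 2.
Proof.
apply: (@complexI R); rewrite [RHS]rmorphM rmorphB rmorph1 /= -!inner_norm2.
rewrite sqr_normcE.
have H : 'X * Phi n = Phi n.+1 + conjc (alpha n) *: rev_poly n (Phi n).
  by rewrite szego_recursion subrK.
have o : inner mu (rev_poly n (Phi n)) (Phi n.+1) = 0.
  by apply: inner_monic_op; exact: size_rev_poly.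
have := innerXX mu (Phi n) (Phi n).
rewrite H innerDr !innerDl !innerZr !innerZl o.
rewrite (inner_conj mu (Phi n.+1) (rev_poly _ _)) o conjc0.
rewrite inner_rev ?size_monic_op // conjcK => E.
by rewrite mulrBl mul1r -{1}E; ring.
Qed.

Lemma normc_verblunsky_lt1 n : normc (alpha n) < 1.
Proof.
rewrite -(@ltr_pXn2r _ 2) ?nnegrE ?normc_ge0 // expr1n -subr_gt0.
rewrite -(pmulr_lgt0 _ (exprn_gt0 2 (norm2_monic_gt0 n))) -norm2_monic_opS.
by rewrite exprn_gt0 // norm2_monic_gt0.
Qed.

Lemma sqrt_1_sub_alpha n : Num.sqrt (1 - (normc (alpha n)) ^+ 2) = N n.+1 / N n.
Proof.
have N0 := norm2_monic_gt0 n.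
have -> : 1 - (normc (alpha n)) ^+ 2 = (N n.+1 / N n) ^+ 2.
  by rewrite exprMn norm2_monic_opS exprVn mulfK // gt_eqF // exprn_gt0.
by rewrite sqrtr_sqr ger0_norm // divr_ge0 ?norm2_ge0.
Qed.

Lemma size_orthonormal_op n : size (orthonormal_op mu n) = n.+1.
Proof.
rewrite size_scale ?size_monic_op //.
by rewrite realC_eq0 invr_eq0 gt_eqF // norm2_monic_gt0.
Qed.

Lemma horner_orthonormal_op n z :
  (orthonormal_op mu n).[z] = (Phi n).[z] / (N n)%:C.
Proof. by rewrite hornerZ mulrC fmorphV. Qed.

Lemma horner_rev_orthonormal_op n z :
  (rev_poly n (orthonormal_op mu n)).[z] = (rev_poly n (Phi n)).[z] / (N n)%:C.
Proof. by rewrite rev_polyZ hornerZ conjc_real mulrC fmorphV. Qed.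

Section Kernel.
Variable zeta : R[i].
Local Notation phi := (orthonormal_op mu).

(** The polynomial [K_(n-1)(., zeta)], which represents evaluation at [zeta] on the
    polynomials of degree less than [n]. *)
Definition kernel_poly n : {poly R[i]} :=
  \sum_(j < n) conjc (phi j).[zeta] *: phi j.

Lemma kernel_polyS n :
  kernel_poly n.+1 = kernel_poly n + conjc (phi n).[zeta] *: phi n.
Proof. exact: big_ord_recr. Qed.

Lemma size_kernel_poly n : (size (kernel_poly n) <= n)%N.
Proof.
elim: n => [|n ih]; first by rewrite /kernel_poly big_ord0 size_poly0.
rewrite kernel_polyS; apply: leq_trans (size_polyD _ _) _.
rewrite geq_max (leq_trans ih) //=; apply: leq_trans (size_scale_leq _ _) _.
by rewrite size_orthonormal_op.
Qed.

Lemma kernel_reproducing n q : (size q <= n)%N ->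
  inner mu (kernel_poly n) q = q.[zeta].
Proof.
elim: n q => [|n ih] q sq.
  move: sq; rewrite leqn0 size_poly_eq0 => /eqP ->.
  by rewrite inner0r horner0.
have N0 : (N n)%:C != 0 by rewrite realC_eq0 gt_eqF // norm2_monic_gt0.
have sq' : (size (q - q`_n *: Phi n)%R <= n)%N.
  apply/leq_sizeP => j; rewrite leq_eqVlt coefB coefZ => /predU1P[<-|nj].
    have /monicP := monic_op_monic n.
    by rewrite lead_coefE size_monic_op /= => ->; rewrite mulr1 subrr.
  by rewrite (nth_default 0 (leq_trans sq nj)) (nth_default 0 (_ : (size (Phi n) <= j)%N))
    ?size_monic_op // mulr0 subrr.
rewrite -(subrK (q`_n *: Phi n) q) innerDr hornerD; congr (_ + _).
  rewrite kernel_polyS innerDl ih // innerZl /orthonormal_op innerZl.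
  by rewrite (inner_conj mu (Phi n)) inner_monic_op // conjc0 !mulr0 addr0.
rewrite innerZr hornerZ; congr (_ * _).
rewrite kernel_polyS innerDl inner_monic_op ?size_kernel_poly // add0r.
rewrite innerZl conjcK horner_orthonormal_op /orthonormal_op innerZl conjc_real.
by rewrite inner_norm2 rmorphXn fmorphV /= expr2 mulKf // divfK.
Qed.

Lemma horner_kernel_poly n :
  (kernel_poly n.+1).[zeta] = (CD_kernel mu n zeta)%:C.
Proof.
rewrite /kernel_poly horner_sum rmorph_sum; apply: eq_bigr => j _ /=.
by rewrite hornerZ sqr_normcE.
Qed.

Lemma CD_kernelS n :
  CD_kernel mu n.+1 zeta = CD_kernel mu n zeta + (normc (phi n.+1).[zeta]) ^+ 2.
Proof. exact: big_ord_recr. Qed.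

Lemma CD_kernel_ge0 n : 0 <= CD_kernel mu n zeta.
Proof. by apply: sumr_ge0 => j _; exact: sqr_ge0. Qed.

(** Projecting [q] on the kernel: the distance from [q] to the line spanned by
    the kernel polynomial has a nonnegative square. *)
Lemma eval_le_kernel n q : (size q <= n.+1)%N ->
  (normc q.[zeta]) ^+ 2 <= CD_kernel mu n zeta * (norm2 mu q) ^+ 2.
Proof.
move=> sq; set K := CD_kernel mu n zeta; set k := kernel_poly n.+1.
have kk : inner mu k k = K%:C by rewrite kernel_reproducing ?size_kernel_poly ?horner_kernel_poly.
have kq : inner mu k q = q.[zeta] by exact: kernel_reproducing.
have [K0|K0] := eqVneq K 0.
  have k0 : k = 0 by apply: inner_eq0; rewrite kk K0.
  by rewrite -kq k0 inner_conj inner0r conjc0 normc0 expr0n /= K0 mul0r.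
have Kp : 0 < K by rewrite lt_def K0 CD_kernel_ge0.
pose t := q.[zeta] / K%:C.
have : 0 <= (norm2 mu (q - t *: k)) ^+ 2 by exact: sqr_ge0.
suff -> : (norm2 mu (q - t *: k)) ^+ 2 = norm2 mu q ^+ 2 - normc q.[zeta] ^+ 2 / K.
  by rewrite subr_ge0 ler_pdivrMr // mulrC.
apply: (@complexI R); rewrite -inner_norm2 innerBr !innerBl innerZr !innerZl.
rewrite innerZr kk kq (inner_conj mu q k) kq /t !conjcM conjcV conjc_real.
rewrite [RHS]rmorphB [in RHS]fmorph_div /= -inner_norm2 sqr_normcE.
have K0' : K%:C != 0 by rewrite realC_eq0.
by field.
Qed.

End Kernel.

Section OnTheCircle.
Variable zeta : R[i].
Hypothesis zeta1 : normc zeta = 1.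

Lemma szego_recursion_horner n : (Phi n.+1).[zeta] =
  zeta * (Phi n).[zeta] - conjc (alpha n) * (rev_poly n (Phi n)).[zeta].
Proof. by rewrite szego_recursion hornerD hornerN hornerM hornerX hornerZ. Qed.

Lemma szego_recursion_rev_horner n : (rev_poly n.+1 (Phi n.+1)).[zeta] =
  (rev_poly n (Phi n)).[zeta] - alpha n * zeta * (Phi n).[zeta].
Proof.
rewrite !horner_rev_poly_circle ?size_monic_op // szego_recursion_horner.
rewrite horner_rev_poly_circle ?size_monic_op //.
rewrite conjcB !conjcM !conjcK conjcX exprS.
have zz := circle_mul_conj zeta1.
have zzn : zeta ^+ n * conjc zeta ^+ n = 1 by rewrite -exprMn zz expr1n.
(* The factors that equal 1 on the circle are isolated. *)
transitivity ((zeta * conjc zeta) * (zeta ^+ n * conjc (Phi n).[zeta])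
  - alpha n * zeta * ((zeta ^+ n * conjc zeta ^+ n) * (Phi n).[zeta])); first by ring.
by rewrite zz zzn !mul1r.
Qed.

(** The sum telescopes along the Szego recursion, because the value of [Phi_j.+1] at 0
    is minus the conjugate of the Verblunsky coefficient [alpha_j]. *)
Lemma horner0_kernel_poly n :
  (kernel_poly zeta n.+1).[0] =
  conjc (rev_poly n (Phi n)).[zeta] / ((N n) ^+ 2)%:C.
Proof.
have N0 k : (N k)%:C != 0 by rewrite realC_eq0 gt_eqF // norm2_monic_gt0.
have conjN k : conjc (N k)%:C = (N k)%:C by exact: conjc_real.
elim: n => [|n ih].
  rewrite kernel_polyS /kernel_poly big_ord0 add0r hornerZ !horner_orthonormal_op.
  rewrite horner_rev_poly_circle ?size_monic_op // expr0 mul1r conjcK.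
  rewrite (monic_orthogonal_uniq (monic_opP 0) monic_orthogonal0) !hornerC.
  by rewrite conjcM conjcV conjc1 (conjc_real (norm2 mu 1)) rmorphXn /= !mul1r expr2 invfM.
rewrite kernel_polyS hornerD ih hornerZ !horner_orthonormal_op horner0_monic_opS.
rewrite szego_recursion_rev_horner szego_recursion_horner.
have rho0 : 1 - conjc (alpha n) * alpha n != 0.
  have := norm2_monic_gt0 n.+1; rewrite -sqr_normcE -(rmorph1 (real_complex R)).
  rewrite -rmorphB realC_eq0 gt_eqF // subr_gt0 expr_lt1 ?normc_ge0 //.
  exact: normc_verblunsky_lt1.
have NS : (N n.+1)%:C ^+ 2 = (1 - conjc (alpha n) * alpha n) * (N n)%:C ^+ 2.
  by rewrite -!rmorphXn /= norm2_monic_opS [LHS]rmorphM rmorphB rmorph1 /= sqr_normcE.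
rewrite !(conjcB, conjcM, conjcV, conjN, conjcK) !rmorphXn /=.
set a := alpha n in rho0 NS *; set U := conjc (Phi n).[zeta].
set V := conjc (rev_poly _ _).[zeta].
rewrite [X in _ + X](_ : _ = (conjc zeta * U - a * V) * (- conjc a)
   / ((1 - conjc a * a) * (N n)%:C ^+ 2)); last by rewrite -NS; field; exact: N0.
by rewrite NS; field; rewrite rho0 N0.
Qed.

End OnTheCircle.
End MonicOrthogonal.

(** * Adding a point mass *)

Section Geronimus.
Context {R : realType}.
Variables mu nu : probability (borelC R) R.
Variables (zeta : R[i]) (gamma : R).
Hypothesis mu_pos : forall p : {poly R[i]}, p != 0 -> 0 < norm2 mu p.
Hypothesis nu_pos : forall p : {poly R[i]}, p != 0 -> 0 < norm2 nu p.
Hypothesis zeta1 : normc zeta = 1.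
Hypothesis gamma01 : 0 < gamma < 1.
Hypothesis innerE : forall p q, inner nu p q =
  (1 - gamma)%:C * inner mu p q + gamma%:C * (conjc p.[zeta] * q.[zeta]).

Local Notation Phi := (monic_op mu).
Local Notation C0 := ((1 - gamma) * gamma^-1).

(** Subtracting a multiple of the kernel changes the pairing with [q] by a multiple
    of [conj q(zeta)], which is exactly what the point mass contributes. *)
Lemma monic_op_point_mass n : monic_op nu n.+1 = Phi n.+1 -
  ((Phi n.+1).[zeta] / (C0 + CD_kernel mu n zeta)%:C) *: kernel_poly mu zeta n.+1.
Proof.
have [g0 g1] := andP gamma01.
have [mP sP oP] := monic_opP mu_pos n.+1.
set t := _ / _; set k := kernel_poly _ _ _.
have sk : (size (- (t *: k))%R < size (Phi n.+1))%N.
  rewrite sP ltnS size_polyN; apply: leq_trans (size_scale_leq _ _) _.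
  exact: size_kernel_poly.
apply: (monic_orthogonal_uniq nu_pos (monic_opP nu_pos n.+1)); split.
- by rewrite monicE lead_coefDl // -monicE.
- by rewrite size_polyDl.
- move=> q sq; rewrite innerE innerBr oP // innerZr (inner_conj mu q k).
  rewrite kernel_reproducing // hornerD hornerN hornerZ horner_kernel_poly.
  rewrite /t; set K := CD_kernel _ _ _.
  have g0' : gamma%:C != 0 by rewrite realC_eq0 gt_eqF.
  have D0 : (C0 + K)%:C != 0.
    rewrite realC_eq0 gt_eqF // ltr_pwDl ?CD_kernel_ge0 // mulr_gt0 ?invr_gt0 //.
    by rewrite subr_gt0.
  have E : (1 - gamma)%:C = gamma%:C * ((C0 + K)%:C - K%:C).
    rewrite -[_ - K%:C]rmorphB -rmorphM /=; congr _%:C.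
    by field; rewrite gt_eqF.
  rewrite E; move: D0; move: (C0 + K)%:C => D D0.
  by field; exact: D0.
Qed.

(** Comparison of the values at 0 of the two monic orthogonal polynomials. *)
Lemma verblunsky_point_mass n :
  verblunsky nu n = verblunsky mu n + Delta mu gamma zeta n.
Proof.
have [g0 g1] := andP gamma01.
apply: (can_inj (@conjcK R)); apply: oppr_inj.
rewrite -horner0_monic_opS // monic_op_point_mass hornerD hornerN hornerZ.
rewrite horner0_monic_opS // horner0_kernel_poly // conjcD opprD; congr (_ - _).
have N0 k : (norm2 mu (Phi k))%:C != 0 by rewrite realC_eq0 gt_eqF // norm2_monic_gt0.
rewrite /Delta sqrt_1_sub_alpha // horner_orthonormal_op horner_rev_orthonormal_op //.
have D0 : (C0 + CD_kernel mu n zeta)%:C != 0.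
  rewrite realC_eq0 gt_eqF // ltr_pwDl ?CD_kernel_ge0 // mulr_gt0 ?invr_gt0 //.
  by rewrite subr_gt0.
rewrite !(conjcM, conjcV, conjcK) !conjc_real fmorph_div rmorphXn /=.
move: D0 (N0 n) (N0 n.+1); move: (C0 + _)%:C (norm2 _ _)%:C (norm2 _ _)%:C => D M M' D0 M0 M1.
by field; rewrite D0 M0 M1.
Qed.

End Geronimus.

(** * Sequences of bounded variation *)

Section NonnegativeSequences.
Context {R : realType}.
Implicit Types (d e : nat -> R).

Lemma cvg0P d : (forall n, 0 <= d n) ->
  d @ \oo --> (0 : R) <->
  (forall eps, 0 < eps -> exists N, forall n, (N <= n)%N -> d n < eps).
Proof.
move=> d0; split => [/cvgrPdist_lt dc eps /dc[N _ NP]|dc].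
  exists N => n /NP /=; rewrite sub0r normrN ger0_norm //.
apply/cvgrPdist_lt => eps /dc[N NP]; exists N => // n /= /NP.
by rewrite sub0r normrN ger0_norm.
Qed.

Lemma cvg0_le d e C N : (forall n, 0 <= d n) -> (forall n, 0 <= e n) ->
  (forall n, (N <= n)%N -> d n <= C * e n) ->
  e @ \oo --> (0 : R) -> d @ \oo --> (0 : R).
Proof.
move=> d0 e0 le ec; apply/(cvg0P d0) => eps eps0.
have C0 : 0 < Num.max C 1 by rewrite lt_max ltr01 orbT.
have [N' N'P] := (cvg0P e0).1 ec _ (divr_gt0 eps0 C0).
exists (maxn N N') => n; rewrite geq_max => /andP[/le h /N'P].
rewrite ltr_pdivlMr // mulrC; apply: le_lt_trans; apply: (le_trans h).
by rewrite ler_wpM2r // le_max lexx.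
Qed.

Lemma summableP d : (forall n, 0 <= d n) ->
  cvgn (series d) <-> exists M, forall n, series d n <= M.
Proof.
move=> d0; split => [dc|[M dM]].
  exists (limn (series d)) => n; apply: nondecreasing_cvgn_le => //.
  exact: nondecreasing_series.
apply: nondecreasing_is_cvgn; first exact: nondecreasing_series.
by exists M => _ [n _ <-].
Qed.

Lemma summable_le d e N : (forall n, 0 <= d n) -> (forall n, 0 <= e n) ->
  (forall n, (N <= n)%N -> d n <= e n) ->
  cvgn (series e) -> cvgn (series d).
Proof.
move=> d0 e0 le /(summableP e0)[M eM]; apply/(summableP d0).
exists (series d N + M) => n.
apply: le_trans (_ : series d N + series e n <= _); last by rewrite lerD2l.
elim: n => [|n ih].
  by rewrite /series /= big_geq // addr_ge0 ?sumr_ge0.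
rewrite seriesSr [series e _]seriesSr.
have [Nn|nN] := leqP N n; first by rewrite addrA lerD // le.
rewrite -seriesSr -[leLHS]addr0 lerD //; last by rewrite addr_ge0 ?sumr_ge0.
exact: nondecreasing_series.
Qed.

(** A contraction with a vanishing perturbation: beyond a large index [d] lies below
    half of [eps] plus a geometric sequence. *)
Lemma contraction_cvg0 d e q N : 0 <= q < 1 -> (forall n, 0 <= d n) ->
  (forall n, 0 <= e n) ->
  (forall n, (N <= n)%N -> d n.+1 <= q * d n + e n) ->
  e @ \oo --> (0 : R) -> d @ \oo --> (0 : R).
Proof.
move=> /andP[q0 q1] d0 e0 le ec; apply/(cvg0P d0) => eps eps0.
have q1' : 0 < 1 - q by rewrite subr_gt0.
have [N1 N1P] : exists N1, forall n, (N1 <= n)%N -> e n < (1 - q) * (eps / 2).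
  by apply: (cvg0P e0).1 ec _ _; rewrite mulr_gt0 // divr_gt0.
pose M := maxn N N1.
have bound k : d (M + k)%N <= eps / 2 + d M * q ^+ k.
  elim: k => [|k ih]; first by rewrite addn0 expr0 mulr1 lerDr ltW // divr_gt0.
  rewrite addnS; apply: le_trans (le _ _) _.
    by rewrite (leq_trans (leq_maxl N N1)) // leq_addr.
  have h := N1P (M + k)%N (leq_trans (leq_maxr N N1) (leq_addr _ _)).
  have := ler_wpM2l q0 ih; rewrite exprS; move: h.
  set A := eps / 2; set B := q ^+ k; set D := d M.
  rewrite (_ : q * (A + D * B) = q * A + D * (q * B)); last by ring.
  by rewrite mulrBl mul1r; lra.
have qc : (fun k => d M * q ^+ k) @ \oo --> (0 : R).
  by rewrite -[X in _ --> X](mulr0 (d M)); apply: cvgMr; apply: cvg_expr; rewrite ger0_norm.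
have qk0 k : 0 <= d M * q ^+ k by rewrite mulr_ge0 // exprn_ge0.
have [K KP] := (cvg0P qk0).1 qc _ (divr_gt0 eps0 (ltr0Sn R 1)).
exists (M + K)%N => n Mn; have Mn' : (M <= n)%N by rewrite (leq_trans _ Mn) // leq_addr.
rewrite -(subnKC Mn'); apply: le_lt_trans (bound _) _.
by rewrite [ltRHS]splitr ltrD2l KP // leq_subRL.
Qed.

(** Summing the recursion bounds a partial sum of [d] by [q] times itself plus a
    constant, and [q < 1]. *)
Lemma contraction_summable d e q N : 0 <= q < 1 -> (forall n, 0 <= d n) ->
  (forall n, 0 <= e n) ->
  (forall n, (N <= n)%N -> d n.+1 <= q * d n + e n) ->
  cvgn (series e) -> cvgn (series d).
Proof.
move=> /andP[q0 q1] d0 e0 le /(summableP e0)[M eM]; apply/(summableP d0).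
have q1' : 0 < 1 - q by rewrite subr_gt0.
have bound n : series d n.+1 <= series d N.+1 + (q * series d n + series e n).
  elim: n => [|n ih].
    rewrite -[leLHS]addr0 lerD //; first exact: nondecreasing_series.
    by rewrite /series /= !big_geq // mulr0 addr0.
  rewrite seriesSr [series d n.+1 in leRHS]seriesSr [series e _]seriesSr.
  have [Nn|nN] := leqP N n.
    by have := le _ Nn; move: ih; rewrite mulrDr; lra.
  rewrite -seriesSr -[leLHS]addr0 lerD //; first exact: nondecreasing_series.
  by rewrite !addr_ge0 ?mulr_ge0 ?addr_ge0 ?sumr_ge0.
exists ((series d N.+1 + M) / (1 - q)) => n; rewrite ler_pdivlMr //.
have mono : series d n <= series d n.+1 by exact: nondecreasing_series.
by have := bound n; have := eM n; rewrite mulrBr mulr1 [_ * q]mulrC; lra.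
Qed.

End NonnegativeSequences.

Section BoundedVariation.
Context {R : realType}.
Implicit Types (a b x g : nat -> R[i]) (k l m : R[i]).

Definition ccvg a l : Prop := (fun n => normc (a n - l)) @ \oo --> (0 : R).

(** Carrying the limit along with the bounded variation makes the notion stable under
    inversion when the limit is nonzero. *)
Definition bv_cvg a l : Prop := ccvg a l /\ bounded_var a.

Lemma ccvgP a l : ccvg a l <-> (a : nat -> R[i]^o) @ \oo --> (l : R[i]^o).
Proof.
have h := cvg0P (fun n => normc_ge0 (a n - l)); split.
  move=> /h ac; apply/cvgrPdist_lt => -[x y]; rewrite ltcE /= => /andP[/eqP -> x0].
  have [N NP] := ac x x0; exists N => // n /= /NP.
  by rewrite normr_normc normcB -ltcR.
move=> /cvgrPdist_lt ac; apply/h => eps eps0.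
have [|N _ NP] := ac eps%:C; first by rewrite ltcR.
by exists N => n /NP /=; rewrite normr_normc normcB ltcR.
Qed.

Lemma ccvg_eps a l eps : ccvg a l -> 0 < eps ->
  exists N, forall n, (N <= n)%N -> normc (a n - l) < eps.
Proof. by move=> /(cvg0P (fun n => normc_ge0 (a n - l))); exact. Qed.

Lemma ccvg_normc_le a l M : ccvg a l -> normc l < M ->
  exists N, forall n, (N <= n)%N -> normc (a n) <= M.
Proof.
move=> al lM; have [|N NP] := @ccvg_eps a l (M - normc l) al; first by rewrite subr_gt0.
exists N => n /NP; have := lerB_normc (a n) l; lra.
Qed.

Lemma ccvg_normc_ge a l M : ccvg a l -> M < normc l ->
  exists N, forall n, (N <= n)%N -> M <= normc (a n).
Proof.
move=> al lM; have [|N NP] := @ccvg_eps a l (normc l - M) al; first by rewrite subr_gt0.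
exists N => n /NP; have := lerB_normc l (a n); rewrite normcB; lra.
Qed.

Lemma bv_cvg_cst k : bv_cvg (fun=> k) k.
Proof.
have z : (fun=> normc (k - k)) = (fun=> 0) :> (nat -> R).
  by apply/funext => n; rewrite subrr normc0.
split; first by rewrite /ccvg z; exact: cvg_cst.
rewrite /bounded_var z; apply/summableP => //; exists 0 => n.
by rewrite /series /= big1.
Qed.

Lemma bv_cvg_conj a l : bv_cvg a l -> bv_cvg (fun n => conjc (a n)) (conjc l).
Proof.
have z k m : normc (conjc k - conjc m) = normc (k - m) by rewrite -conjcB normc_conj.
move=> [al av]; split; first by rewrite /ccvg; under eq_fun do rewrite z.
by rewrite /bounded_var; under eq_fun do rewrite z.
Qed.

Lemma bv_cvgD a b l m : bv_cvg a l -> bv_cvg b m ->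
  bv_cvg (fun n => a n + b n) (l + m).
Proof.
have z (s t u v : R[i]) : normc (s + t - (u + v)) <= normc (s - u) + normc (t - v).
  by rewrite opprD addrACA le_normcD.
move=> [al av] [bm bv]; split.
  apply: (@cvg0_le _ _ (fun n => normc (a n - l) + normc (b n - m)) 1 0) => [n|n|n _|].
  - exact: normc_ge0.
  - by rewrite addr_ge0 ?normc_ge0.
  - by rewrite mul1r z.
  - by rewrite -[X in _ --> X](addr0 0); apply: cvgD.
apply: (@summable_le _ _ (fun n => normc (a n.+1 - a n) + normc (b n.+1 - b n)) 0).
- by move=> n; exact: normc_ge0.
- by move=> n; rewrite addr_ge0 ?normc_ge0.
- by move=> n _; rewrite z.
- exact: is_cvg_seriesD.
Qed.

Lemma le_normc_distM (s t u v : R[i]) :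
  normc (s * t - u * v) <= normc s * normc (t - v) + normc v * normc (s - u).
Proof.
rewrite (_ : _ - _ = s * (t - v) + v * (s - u)); last by ring.
by apply: le_trans (le_normcD _ _) _; rewrite !normcM.
Qed.

Lemma ltr_normc1 l : normc l < normc l + 1.
Proof. by rewrite ltrDl. Qed.

Lemma summable_comb (d e : nat -> R) (C : R) : (forall n, 0 <= d n) ->
  (forall n, 0 <= e n) -> cvgn (series d) -> cvgn (series e) ->
  cvgn (series (fun n => C * (d n + e n))).
Proof.
move=> d0 e0 dc ec; apply: (@is_cvg_seriesZ _ (fun n => d n + e n) C).
exact: is_cvg_seriesD.
Qed.

Lemma bv_cvgM a b l m : bv_cvg a l -> bv_cvg b m ->
  bv_cvg (fun n => a n * b n) (l * m).
Proof.
move=> [al av] [bm bv].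
have [N aN] := ccvg_normc_le al (ltr_normc1 l).
have [N' bN] := ccvg_normc_le bm (ltr_normc1 m).
pose C := normc l + 1 + (normc m + 1).
have l1 : 0 <= normc l + 1 by rewrite addr_ge0 ?normc_ge0.
have m1 : 0 <= normc m + 1 by rewrite addr_ge0 ?normc_ge0.
have comb (s t u v : R) : 0 <= u -> 0 <= v -> s <= C -> t <= C ->
    s * u + t * v <= C * (u + v).
  by move=> u0 v0 sC tC; rewrite mulrDr lerD // ler_wpM2r.
split.
  apply: (@cvg0_le _ _ (fun n => normc (b n - m) + normc (a n - l)) C N) => [n|n|n|].
  - exact: normc_ge0.
  - by rewrite addr_ge0 ?normc_ge0.
  - move=> /aN h; apply: le_trans (le_normc_distM _ _ _ _) _.
    by apply: comb; rewrite ?normc_ge0 // /C; have := normc_ge0 l; lra.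
  - by rewrite -[X in _ --> X](addr0 0); apply: cvgD.
apply: (@summable_le _ _ (fun n => C * (normc (b n.+1 - b n) + normc (a n.+1 - a n)))
  (maxn N N')).
- by move=> n; exact: normc_ge0.
- by move=> n; rewrite mulr_ge0 ?addr_ge0 ?normc_ge0.
- move=> n; rewrite geq_max => /andP[Nn /bN h].
  have h' := aN n.+1 (leqW Nn).
  apply: le_trans (le_normc_distM _ _ _ _) _.
  by apply: comb; rewrite ?normc_ge0 // /C; lra.
- by apply: summable_comb => // n; exact: normc_ge0.
Qed.

Lemma bv_cvgN a l : bv_cvg a l -> bv_cvg (fun n => - a n) (- l).
Proof.
move=> al; rewrite -mulN1r; under eq_fun do rewrite -mulN1r.
exact: bv_cvgM (bv_cvg_cst _) al.
Qed.

Lemma bv_cvgB a b l m : bv_cvg a l -> bv_cvg b m ->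
  bv_cvg (fun n => a n - b n) (l - m).
Proof. by move=> al /bv_cvgN; exact: bv_cvgD. Qed.

Lemma bv_cvgV a l : l != 0 -> bv_cvg a l -> bv_cvg (fun n => (a n)^-1) l^-1.
Proof.
move=> l0 [al av]; have lp : 0 < normc l by rewrite normc_gt0.
have l2 : 0 < normc l / 2 by rewrite divr_gt0.
have [|N aN] := @ccvg_normc_ge a l (normc l / 2) al; first lra.
pose C := (normc l / 2) ^- 2.
have dV (s t : R[i]) : normc l / 2 <= normc s -> normc l / 2 <= normc t ->
    normc (s^-1 - t^-1) <= C * normc (s - t).
  move=> hs ht.
  have s0 : s != 0 by rewrite -normc_gt0 (lt_le_trans l2).
  have t0 : t != 0 by rewrite -normc_gt0 (lt_le_trans l2).
  rewrite (_ : _ - _ = (s * t)^-1 * (t - s)); last by field; rewrite s0 t0.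
  rewrite normcM normcV normcM normcB ler_wpM2r ?normc_ge0 //.
  have st : 0 < normc s * normc t by rewrite mulr_gt0 ?normc_gt0.
  rewrite lef_pV2 ?posrE ?exprn_gt0 // expr2; apply: ler_pM => //; exact: ltW.
split.
  apply: (@cvg0_le _ _ (fun n => normc (a n - l)) C N) => // [n|n|n /aN h].
  - exact: normc_ge0.
  - exact: normc_ge0.
  - by apply: dV => //; lra.
apply: (@summable_le _ _ (fun n => C * normc (a n.+1 - a n)) N).
- by move=> n; exact: normc_ge0.
- by move=> n; rewrite mulr_ge0 ?normc_ge0 // invr_ge0 exprn_ge0 // ltW.
- by move=> n Nn; apply: dV; apply: aN => //; exact: leqW.
- exact: (@is_cvg_seriesZ _ (fun n => normc (a n.+1 - a n)) C).
Qed.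

(** The map [x |-> 1 + x * g] contracts towards its fixed point, both in value and
    in variation. *)
Lemma bv_cvg_affine x g k : (forall n, x n.+1 = 1 + x n * g n) ->
  bv_cvg g k -> normc k < 1 -> bv_cvg x (1 - k)^-1.
Proof.
move=> xS [gk gv] k1; set l := (1 - k)^-1.
have k1' : 1 - k != 0.
  by rewrite subr_eq0; apply: contraTneq k1 => <-; rewrite normc1 ltxx.
have lE : l = 1 + l * k by rewrite /l; field.
have [|N gN] := @ccvg_normc_le g k ((1 + normc k) / 2) gk; first lra.
have q01 : 0 <= (1 + normc k) / 2 < 1 by have := normc_ge0 k; lra.
have diff n m : normc (x n.+1 - (1 + m)) = normc (x n * g n - m).
  by rewrite xS opprD addrACA subrr add0r.
have xl : ccvg x l.
  apply: (@contraction_cvg0 _ _ (fun n => normc l * normc (g n - k)) _ N q01) => [n|n|n Nn|].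
  - exact: normc_ge0.
  - by rewrite mulr_ge0 ?normc_ge0.
  - rewrite {1}lE diff mulrC [l * k]mulrC.
    apply: le_trans (le_normc_distM _ _ _ _) _.
    by rewrite lerD2r ler_wpM2r ?normc_ge0 // gN.
  - by rewrite -[X in _ --> X](mulr0 (normc l)); apply: cvgMr.
split => //.
have [N' xN] := ccvg_normc_le xl (ltr_normc1 l).
apply: (@contraction_summable _ _ (fun n => (normc l + 1) * normc (g n.+1 - g n)) _
  (maxn N N') q01).
- by move=> n; exact: normc_ge0.
- by move=> n; rewrite mulr_ge0 ?addr_ge0 ?normc_ge0.
- move=> n; rewrite geq_max => /andP[Nn /xN h].
  have -> : normc (x n.+2 - x n.+1) = normc (g n.+1 * x n.+1 - g n * x n).
    by rewrite ![g _ * _]mulrC -diff -xS.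
  apply: le_trans (le_normc_distM _ _ _ _) _.
  by rewrite lerD // ler_wpM2r ?normc_ge0 // gN // leqW.
- exact: (@is_cvg_seriesZ _ (fun n => normc (g n.+1 - g n)) _).
Qed.

End BoundedVariation.

(** * Hyperbolic recursions *)

Section Dichotomy.
Context {R : realType}.
Implicit Types (A B eta rho : nat -> R).

(** The finitely many exceptional indices are absorbed in the constant. *)
Lemma geometric_bound_eventually (d : nat -> R) (C r : R) N : 0 < r ->
  (forall n, 0 <= d n) -> (forall n, (N <= n)%N -> d n <= C * r ^+ n) ->
  exists2 C', 0 < C' & forall n, d n <= C' * r ^+ n.
Proof.
move=> r0 d0 le.
have rn k : 0 < r ^+ k by exact: exprn_gt0.
have S0 : 0 <= \sum_(k < N) d k / r ^+ k.
  by rewrite sumr_ge0 // => k _; rewrite divr_ge0 // ltW.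
exists (`|C| + 1 + \sum_(k < N) d k / r ^+ k).
  by rewrite ltr_wpDr // ltr_wpDl.
move=> n; rewrite -ler_pdivrMr //; have [Nn|nN] := leqP N n.
  rewrite -addrA; apply: le_trans (_ : C <= _).
    by rewrite ler_pdivrMr // le.
  by apply: le_trans (ler_norm C) _; rewrite lerDl addr_ge0.
rewrite (bigD1 (Ordinal nN)) //= addrCA lerDl !addr_ge0 //.
by rewrite sumr_ge0 // => k _; rewrite divr_ge0 // ltW.
Qed.

Lemma geometric_bound (d : nat -> R) (r : R) N : 0 < r -> (forall n, 0 <= d n) ->
  (forall n, (N <= n)%N -> d n.+1 <= r * d n) ->
  exists2 C, 0 < C & forall n, d n <= C * r ^+ n.
Proof.
move=> r0 d0 le; apply: (@geometric_bound_eventually _ (d N / r ^+ N) r N) => // n Nn.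
have rN : 0 < r ^+ N by exact: exprn_gt0.
rewrite -{2}(subnKC Nn) exprD mulrA divfK ?gt_eqF // -(subnKC Nn).
rewrite [(N + _ - N)%N]addKn; elim: (n - N)%N => [|k ih].
  by rewrite addn0 expr0 mulr1.
rewrite addnS exprS; apply: le_trans (le _ (leq_addr _ _)) _.
by rewrite mulrCA ler_pM2l.
Qed.

(** [A] and [B] are the moduli of the components of a solution along the growing and
    the decaying eigenvector of the limiting transfer matrix; [rho0] is the limit of
    the normalization and [eta] measures the distance to the limit. *)
Section HyperbolicPair.
Variables (A B eta rho : nat -> R) (c s rho0 : R).
Hypotheses (A0 : forall n, 0 <= A n) (B0 : forall n, 0 <= B n).
Hypotheses (eta0 : forall n, 0 <= eta n) (rho_gt0 : forall n, 0 < rho n).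
Hypotheses (AB0 : forall n, 0 < A n + B n).
Hypotheses (s_gt0 : 0 < s) (s_lt_c : s < c) (rho0_lt : c - s < rho0 < c + s).
Hypothesis eta_cvg : eta @ \oo --> (0 : R).
Hypothesis rho_cvg : rho @ \oo --> rho0.
Hypothesis growA : forall n,
  (c + s) * A n - eta n * (A n + B n) <= rho n * A n.+1.
Hypothesis growB : forall n,
  rho n * B n.+1 <= (c - s) * B n + eta n * (A n + B n).

Let eta_le eps : 0 < eps -> exists N, forall n, (N <= n)%N -> eta n <= eps.
Proof. by move=> /((cvg0P eta0).1 eta_cvg)[N NP]; exists N => n /NP/ltW. Qed.

Let rho_near eps : 0 < eps ->
  exists N, forall n, (N <= n)%N -> rho0 - eps <= rho n <= rho0 + eps.
Proof.
move=> /((cvgrPdist_le _ _).1 rho_cvg)[N _ NP]; exists N => n /NP /=.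
by rewrite ler_norml; lra.
Qed.

(** The cone [B <= A] is invariant as soon as the perturbation is small. *)
Lemma cone_dichotomy : exists N,
  (forall n, (N <= n)%N -> B n <= A n) \/ (forall n, (N <= n)%N -> A n <= B n).
Proof.
have [|N NP] := @eta_le (s / 4); first by rewrite divr_gt0.
have [[M [NM BA]]|no] := pselect (exists M, (N <= M)%N /\ B M <= A M); last first.
  exists N; right => n Nn; apply: contrapT => /negP; rewrite -ltNge => /ltW AB.
  by apply: no; exists n.
exists M; left => n Mn; rewrite -(subnKC Mn); elim: (n - M)%N => [|k ih].
  by rewrite addn0.
rewrite addnS; set m := (M + k)%N in ih *.
have em : eta m <= s / 4 by apply: NP; rewrite (leq_trans NM) // leq_addr.
rewrite -(ler_pM2l (rho_gt0 m)).
apply: le_trans (growB m) (le_trans _ (growA m)).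
have h1 : eta m * (A m + B m) <= s / 4 * (A m + A m).
  by apply: ler_pM => //; [exact: addr_ge0|rewrite lerD2l].
have h2 : (c - s) * B m <= (c - s) * A m by rewrite ler_wpM2l // subr_ge0 ltW.
have h3 : 0 <= s * A m by rewrite mulr_ge0 // ltW.
by move: h1 h2 h3; rewrite !mulrDl !mulNr; lra.
Qed.

Lemma decay_outside_cone N : (forall n, (N <= n)%N -> A n <= B n) ->
  exists C r, [/\ 0 < C, 0 < r, r < 1 & forall n, (N <= n)%N -> A n + B n <= C * r ^+ n].
Proof.
move=> AB; have /andP[r1 r2] := rho0_lt.
pose eps := (rho0 - (c - s)) / 4.
have eps0 : 0 < eps by rewrite divr_gt0 // subr_gt0.
have [N1 N1P] := rho_near eps0.
have [N2 N2P] := eta_le (divr_gt0 eps0 (ltr0Sn R 1)).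
have re0 : 0 < rho0 - eps by move: s_lt_c r1 r2; rewrite /eps; lra.
pose r := (c - s + eps) / (rho0 - eps).
have r_gt0 : 0 < r by rewrite divr_gt0 //; move: s_lt_c r1 r2; rewrite /eps; lra.
have r_lt1 : r < 1 by rewrite ltr_pdivrMr // mul1r; move: r1; rewrite /eps; lra.
have step n : (maxn N (maxn N1 N2) <= n)%N -> B n.+1 <= r * B n.
  rewrite !geq_max => /andP[Nn /andP[/N1P/andP[h1 _] /N2P h2]].
  rewrite /r mulrAC ler_pdivlMr // mulrC.
  apply: le_trans (_ : rho n * B n.+1 <= _); first by rewrite ler_wpM2r.
  apply: le_trans (growB n) _.
  have : eta n * (A n + B n) <= eps / 2 * (B n + B n).
    by apply: ler_pM => //; [exact: addr_ge0|rewrite lerD2r AB].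
  by rewrite !mulrDr !mulrDl; lra.
have [C C0 CP] := geometric_bound r_gt0 B0 step.
exists (2 * C), r; split => //; first exact: mulr_gt0.
move=> n Nn; apply: le_trans (_ : 2 * B n <= _).
  by rewrite mulr2n mulrDl !mul1r lerD2r AB.
by rewrite -mulrA ler_pM2l.
Qed.

Section InsideCone.
Variable N0 : nat.
Hypothesis BA : forall n, (N0 <= n)%N -> B n <= A n.

Let A_gt0 n : (N0 <= n)%N -> 0 < A n.
Proof.
move=> /BA h; rewrite lt_def A0 andbT; apply: contraTneq (AB0 n) => An.
by move: h; rewrite An add0r -leNgt.
Qed.

(** In the cone the perturbation is at most [2 * eta n * A n], so [A] grows by a factor
    bounded below by a number larger than 1; equivalently [1 / A] contracts. *)
Lemma unbounded_in_cone M : exists2 n, (N0 <= n)%N & M < A n.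
Proof.
apply: contrapT => no; have AM n : (N0 <= n)%N -> A n <= M.
  by move=> Nn; rewrite leNgt; apply/negP => MA; apply: no; exists n.
have /andP[r1 r2] := rho0_lt.
pose eps := (c + s - rho0) / 4.
have eps0 : 0 < eps by rewrite divr_gt0 // subr_gt0.
have [N1 N1P] := rho_near eps0.
have [N2 N2P] := eta_le (divr_gt0 eps0 (ltr0Sn R 1)).
have ce0 : 0 < c + s - eps by move: s_lt_c r1 r2; rewrite /eps; lra.
pose q := (rho0 + eps) / (c + s - eps).
have q01 : 0 <= q < 1.
  by rewrite divr_ge0 ?(ltW ce0) ?ltr_pdivrMr //=; move: s_lt_c r1 r2; rewrite /eps; lra.
pose N := maxn N0 (maxn N1 N2).
have M0 : 0 < M by apply: lt_le_trans (AM _ (leqnn _)); exact: A_gt0.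
have : (fun n => (A n)^-1) @ \oo --> (0 : R).
  apply: (@contraction_cvg0 _ _ (fun=> 0) q N q01) => // [n|n|].
  - by rewrite invr_ge0.
  - rewrite !geq_max => /andP[Nn /andP[/N1P/andP[_ h1] /N2P h2]].
    have An := A_gt0 Nn; have An' := A_gt0 (leqW Nn).
    have re0 : 0 < rho0 + eps by move: s_lt_c r1 r2; rewrite /eps; lra.
    have h : (c + s - eps) * A n <= (rho0 + eps) * A n.+1.
      apply: le_trans (_ : rho n * A n.+1 <= _); last by rewrite ler_wpM2r // ltW.
      apply: le_trans _ (growA n).
      have : eta n * (A n + B n) <= eps / 2 * (A n + A n).
        by apply: ler_pM => //; [exact: addr_ge0|rewrite lerD2l BA].
      by rewrite !mulrDr !mulrDl !mulNr; lra.
    rewrite addr0 (_ : q * _ = ((c + s - eps) * A n / (rho0 + eps))^-1); last first.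
      by rewrite /q; field; rewrite !gt_eqF.
    rewrite lef_pV2 ?posrE // ?divr_gt0 ?mulr_gt0 // ler_pdivrMr //.
    by rewrite [A n.+1 * _]mulrC.
  - exact: cvg_cst.
have Ai n : 0 <= (A n)^-1 by rewrite invr_ge0.
move=> /(cvg0P Ai) /(_ M^-1); rewrite invr_gt0 => /(_ M0)[N' N'P].
have := N'P (maxn N0 N') (leq_maxr _ _).
rewrite ltf_pV2 ?posrE ?A_gt0 ?leq_maxl // ltNge => /negP; apply.
exact/AM/leq_maxl.
Qed.

(** The normalization [rho] cancels in the quotient, which contracts by the
    factor [(c - s) / c] once the perturbation is small. *)
Lemma quotient_cvg0_in_cone : (fun n => B n / A n) @ \oo --> (0 : R).
Proof.
have [N NP] := eta_le (divr_gt0 s_gt0 (ltr0Sn R 1)).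
have c0 : 0 < c by exact: lt_trans s_gt0 s_lt_c.
pose q := (c - s) / c.
have q01 : 0 <= q < 1.
  by rewrite divr_ge0 ?ltr_pdivrMr ?(ltW c0) //= ?subr_ge0 ?(ltW s_lt_c) // mul1r; move: s_gt0; lra.
apply: (@contraction_cvg0 _ _ (fun n => 2 / c * eta n) q (maxn N0 N) q01) => [n|n|n|].
- by rewrite divr_ge0.
- by rewrite mulr_ge0 // divr_ge0 // ltW.
- rewrite geq_max => /andP[Nn /NP h].
  have An := A_gt0 Nn; have An' := A_gt0 (leqW Nn).
  have e1 : eta n * (A n + B n) <= eta n * (A n + A n).
    by rewrite ler_wpM2l // lerD2l BA.
  have e2 : eta n * A n <= s / 2 * A n by rewrite ler_wpM2r // ltW.
  have up : rho n * B n.+1 <= (c - s) * B n + 2 * eta n * A n.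
    by apply: le_trans (growB n) _; move: e1; rewrite !mulrDr; lra.
  have lo : c * A n <= rho n * A n.+1.
    apply: le_trans (growA n); move: e1 e2; rewrite !mulrDr !mulrDl; lra.
  rewrite ler_pdivrMr // -(ler_pM2l (rho_gt0 n)).
  apply: (le_trans up); rewrite mulrCA.
  have -> : (c - s) * B n + 2 * eta n * A n =
      (q * (B n / A n) + 2 / c * eta n) * (c * A n).
    by rewrite /q; field; rewrite !gt_eqF.
  rewrite ler_wpM2l // addr_ge0 ?mulr_ge0 ?divr_ge0 ?invr_ge0 ?(ltW c0) //.
  by rewrite subr_ge0 ltW.
- by rewrite -[X in _ --> X](mulr0 (2 / c)); apply: cvgMr.
Qed.

End InsideCone.
End HyperbolicPair.
End Dichotomy.

(** * The Szego recursion in the gap *)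

(** Here [e = c + i S] is a square root of the spectral parameter and [w = s + i S]
    has modulus [|L|]; all identities below follow from [e - conj e = w - conj w],
    [conj e * e = 1] and [conj w * w = conj L * L]. *)
Section GapDynamics.
Context {R : realType}.
Variables (c s S : R) (L : R[i]).
Hypotheses (c_gt0 : 0 < c) (s_gt0 : 0 < s).
Hypotheses (cS : c ^+ 2 + S ^+ 2 = 1) (sS : s ^+ 2 + S ^+ 2 = (normc L) ^+ 2).
Hypothesis (L_lt1 : normc L < 1).

Local Notation e := (c +i* S).
Local Notation w := (s +i* S).
Local Notation zeta := (e * e).

Lemma gap_s_lt_c : s < c.
Proof.
rewrite -(@ltr_pXn2r _ 2) ?nnegrE ?ltW //.
have : (normc L) ^+ 2 < 1 by rewrite expr_lt1 ?normc_ge0.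
by move: cS sS; lra.
Qed.

Lemma gap_L_gt0 : 0 < normc L.
Proof.
rewrite lt_def normc_ge0 andbT; apply/eqP => L0.
have := sS; rewrite L0 expr0n /= => h.
have : 0 < s ^+ 2 by rewrite exprn_gt0.
by have := sqr_ge0 S; move: h; lra.
Qed.

Lemma gap_L_neq0 : L != 0.
Proof. by rewrite -normc_gt0 gap_L_gt0. Qed.

Lemma gap_normc_e : normc e = 1.
Proof. by rewrite /normc cS sqrtr1. Qed.

Lemma gap_normc_w : normc w = normc L.
Proof. by rewrite /normc sS sqrtr_sqr ger0_norm // normc_ge0. Qed.

Lemma gap_normc_zeta : normc zeta = 1.
Proof. by rewrite normcM gap_normc_e mulr1. Qed.

Lemma gap_ee : conjc e * e = 1.
Proof. by rewrite -sqr_normcE gap_normc_e expr1n. Qed.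

Lemma gap_ww : conjc w * w = conjc L * L.
Proof. by rewrite -!sqr_normcE gap_normc_w. Qed.

Lemma gap_eDw : e + conjc w = (c + s)%:C.
Proof. by simpc; congr (_ +i* _); ring. Qed.

Lemma gap_eBw : e - w = (c - s)%:C.
Proof. by simpc; congr (_ +i* _); ring. Qed.

Lemma gap_ceDw : conjc e + w = (c + s)%:C.
Proof. by simpc; congr (_ +i* _); ring. Qed.

Lemma gap_wDw : w + conjc w = (2 * s)%:C.
Proof. by simpc; congr (_ +i* _); ring. Qed.

(** The two fixed points of the limiting Moebius map
    [r |-> (zeta r - conj L) / (1 - L zeta r)] of the unit circle. *)
Definition repelling_point : R[i] := conjc e * conjc w / L.
Definition attracting_point : R[i] := - (conjc e * w) / L.
Local Notation rp := repelling_point.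
Local Notation rm := attracting_point.

Lemma normc_repelling_point : normc rp = 1.
Proof.
rewrite /rp !normcM normcV !normc_conj gap_normc_e gap_normc_w mul1r.
by rewrite divff // gt_eqF // gap_L_gt0.
Qed.

Lemma normc_attracting_point : normc rm = 1.
Proof.
rewrite /rm normcM normcN normcM normcV normc_conj gap_normc_e gap_normc_w mul1r.
by rewrite divff // gt_eqF // gap_L_gt0.
Qed.

Lemma repelling_eigenvalue : zeta * (1 + L * rp) = e * (c + s)%:C.
Proof.
have L0 := gap_L_neq0; rewrite /rp -gap_eDw.
transitivity (e * (e + (conjc e * e) * conjc w)); first by field.
by rewrite gap_ee mul1r.
Qed.

Lemma attracting_eigenvalue : zeta * (1 + L * rm) = e * (c - s)%:C.
Proof.
have L0 := gap_L_neq0; rewrite /rm -gap_eBw.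
transitivity (e * (e - (conjc e * e) * w)); first by field.
by rewrite gap_ee mul1r.
Qed.

Lemma repelling_fixed : e * (c + s)%:C * rp = conjc L + rp.
Proof.
have L0 := gap_L_neq0; have ww := gap_ww; have ee := gap_ee.
apply: (mulIf L0); rewrite /rp -gap_ceDw mulrDl -ww.
transitivity ((conjc e * e) * (conjc e + w) * conjc w); first by field.
rewrite ee; by field.
Qed.

Lemma attracting_fixed : e * (c - s)%:C * rm = conjc L + rm.
Proof.
have L0 := gap_L_neq0; have ww := gap_ww; have ee := gap_ee.
have E : (c - s)%:C = conjc e - conjc w by simpc; congr (_ +i* _); ring.
apply: (mulIf L0); rewrite /rm E mulrDl -ww.
transitivity (- (conjc e * e) * (conjc e - conjc w) * w); first by field.
rewrite ee; by field.
Qed.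

Lemma attracting_denominator : 1 - L * (zeta * rm) = e * (c + s)%:C.
Proof.
have L0 := gap_L_neq0; have ee := gap_ee.
rewrite /rm -gap_ceDw; transitivity (1 + (conjc e * e) * e * w); first by field.
rewrite ee -[X in X + _]ee; ring.
Qed.

Lemma fixed_points_dist : normc (rm - rp) = 2 * s / normc L.
Proof.
have L0 := gap_L_neq0.
rewrite /rm /rp (_ : _ - _ = - (conjc e * (w + conjc w)) / L); last by field.
rewrite gap_wDw normcM normcN normcV normcM normc_conj gap_normc_e mul1r.
by rewrite normc_realC ger0_norm // mulr_ge0 // ltW.
Qed.

Variables (al u v : nat -> R[i]) (rho : nat -> R).
Hypothesis al_lt1 : forall n, normc (al n) < 1.
Hypothesis rhoE : forall n, rho n = Num.sqrt (1 - (normc (al n)) ^+ 2).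
Hypothesis uS : forall n, (rho n)%:C * u n.+1 = zeta * u n - conjc (al n) * v n.
Hypothesis vS : forall n, (rho n)%:C * v n.+1 = v n - al n * zeta * u n.
Hypothesis uv : forall n, normc (u n) = normc (v n).
Hypothesis v_neq0 : forall n, v n != 0.
Hypothesis al_cvg : bv_cvg al L.

Let v_gt0 n : 0 < normc (v n). Proof. by rewrite normc_gt0. Qed.

Let sqr_al_lt1 n : 0 < 1 - (normc (al n)) ^+ 2.
Proof. by rewrite subr_gt0 expr_lt1 ?normc_ge0. Qed.

Let rho_gt0 n : 0 < rho n. Proof. by rewrite rhoE sqrtr_gt0. Qed.

Let sqr_rho n : rho n ^+ 2 = 1 - (normc (al n)) ^+ 2.
Proof. by rewrite rhoE sqr_sqrtr // ltW. Qed.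

Let sqr_rhoC n : (rho n)%:C ^+ 2 = 1 - conjc (al n) * al n.
Proof. by rewrite -rmorphXn /= sqr_rho rmorphB rmorph1 -sqr_normcE. Qed.

Let rho_cvg : rho @ \oo --> Num.sqrt (1 - (normc L) ^+ 2).
Proof.
have -> : rho = fun n => Num.sqrt (1 - (normc (al n)) ^+ 2).
  by apply/funext => n; exact: rhoE.
have nc : (fun n => normc (al n)) @ \oo --> normc L.
  apply/cvgrPdist_lt => eps eps0; have [N NP] := ccvg_eps al_cvg.1 eps0.
  exists N => // n /NP; apply: le_lt_trans => /=.
  rewrite ler_norml; have := lerB_normc L (al n); have := lerB_normc (al n) L.
  by rewrite (normcB L); lra.
apply: (@continuous_cvg _ _ _ _ _ _ Num.sqrt); first exact: sqrt_continuous.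
by apply: cvgB; [exact: cvg_cst|exact: (cvgM nc nc)].
Qed.

(** Along an eigenvector of the limiting transfer matrix the recursion is scalar
    up to an error controlled by [al n - L]. *)
Let eigen_step (r lam : R[i]) n : normc r = 1 -> zeta * (1 + L * r) = lam ->
  lam * r = conjc L + r ->
  normc ((rho n)%:C * (u n.+1 - r * v n.+1) - lam * (u n - r * v n)) <=
  2 * normc (al n - L) * normc (v n).
Proof.
move=> r1 lamE lamr.
have -> : (rho n)%:C * (u n.+1 - r * v n.+1) - lam * (u n - r * v n) =
    zeta * r * (al n - L) * u n - conjc (al n - L) * v n.
  transitivity ((rho n)%:C * u n.+1 - r * ((rho n)%:C * v n.+1) - lam * u n
    + lam * r * v n); first by ring.
  rewrite uS vS lamr -lamE conjcB; ring.
apply: le_trans (le_normcB _ _) _.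
rewrite !normcM normc_conj r1 uv gap_normc_e; lra.
Qed.

Let A n := normc (u n - rp * v n).
Let B n := normc (u n - rm * v n).
Let eta n := normc (al n - L) * (normc L / s).

Let v_le n : 2 * s / normc L * normc (v n) <= A n + B n.
Proof.
rewrite -fixed_points_dist -normcM.
rewrite (_ : (rm - rp) * v n = (u n - rp * v n) - (u n - rm * v n)); last by ring.
exact: le_normcB.
Qed.

Let err_le n : 2 * normc (al n - L) * normc (v n) <= eta n * (A n + B n).
Proof.
have Lp := gap_L_gt0; rewrite /eta.
apply: le_trans (ler_wpM2l _ (v_le n)); last by rewrite mulr_ge0 ?normc_ge0 // divr_ge0 // ltW.
rewrite le_eqVlt; apply/orP; left; apply/eqP; field.
by rewrite !gt_eqF.
Qed.

Let AB_gt0 n : 0 < A n + B n.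
Proof.
apply: lt_le_trans (v_le n); rewrite mulr_gt0 // divr_gt0 ?gap_L_gt0 //.
by rewrite mulr_gt0.
Qed.

Let eta_cvg : eta @ \oo --> (0 : R).
Proof. by rewrite -[X in _ --> X](mul0r (normc L / s)); apply: cvgMl; exact: al_cvg.1. Qed.

Let growA n : (c + s) * A n - eta n * (A n + B n) <= rho n * A n.+1.
Proof.
have := eigen_step n normc_repelling_point repelling_eigenvalue repelling_fixed.
move=> /le_trans /(_ (err_le n)) h.
have := lerB_normc (e * (c + s)%:C * (u n - rp * v n)) ((rho n)%:C * (u n.+1 - rp * v n.+1)).
rewrite normcB => /le_trans /(_ h); rewrite 2!normcM normcM gap_normc_e mul1r !normc_realC.
rewrite !ger0_norm ?addr_ge0 ?(ltW c_gt0) ?(ltW s_gt0) ?(ltW (rho_gt0 n)) //.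
by rewrite -/(A n) -/(A n.+1); lra.
Qed.

Let growB n : rho n * B n.+1 <= (c - s) * B n + eta n * (A n + B n).
Proof.
have := eigen_step n normc_attracting_point attracting_eigenvalue attracting_fixed.
move=> /le_trans /(_ (err_le n)) h.
have := lerB_normc ((rho n)%:C * (u n.+1 - rm * v n.+1)) (e * (c - s)%:C * (u n - rm * v n)).
move=> /le_trans /(_ h); rewrite 3!normcM gap_normc_e mul1r !normc_realC.
rewrite !ger0_norm ?subr_ge0 ?(ltW gap_s_lt_c) ?(ltW (rho_gt0 n)) //.
by rewrite -/(B n) -/(B n.+1); lra.
Qed.

Let rho0 := Num.sqrt (1 - (normc L) ^+ 2).

Let rho0_lt : c - s < rho0 < c + s.
Proof.
have sc := gap_s_lt_c.
have cc : 1 - (normc L) ^+ 2 = c ^+ 2 - s ^+ 2 by rewrite -sS -cS; ring.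
have c2 : 0 <= c ^+ 2 - s ^+ 2 by rewrite subr_sqr mulr_ge0 // ?subr_ge0 ?addr_ge0 // ltW.
have sc0 : 0 < s * (c - s) by rewrite mulr_gt0 // subr_gt0.
apply/andP; split; rewrite -(@ltr_pXn2r _ 2) ?nnegrE ?sqrtr_ge0 ?subr_ge0 ?addr_ge0 ?(ltW sc) ?(ltW s_gt0) ?(ltW c_gt0) //;
  rewrite /rho0 cc sqr_sqrtr //.
- by rewrite sqrrB; move: sc0; rewrite mulrBr -expr2 mulr2n [c * s]mulrC; lra.
- have : 0 < s * c by rewrite mulr_gt0.
  have := sqr_ge0 s; rewrite sqrrD mulr2n [c * s]mulrC => ? ?.
  have : 0 < s ^+ 2 by rewrite exprn_gt0.
  lra.
Qed.

(** The components [u n - rp * v n] and [u n - rm * v n] along the two eigenvectors form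
    a hyperbolic pair.  Their moduli differ by at most a multiple of [|v n|], which turns
    a small quotient of the two into closeness of [u n / v n] to the attracting point. *)
Lemma gap_alternative :
  (exists C r, [/\ 0 < C, 0 < r, r < 1 & forall n, normc (v n) <= C * r ^+ n]) \/
  ((forall M, exists n, M < normc (v n)) /\ ccvg (fun n => u n / v n) rm).
Proof.
have Lp := gap_L_gt0.
have A0 n : 0 <= A n by exact: normc_ge0.
have B0 n : 0 <= B n by exact: normc_ge0.
have eta0 n : 0 <= eta n by rewrite mulr_ge0 ?normc_ge0 // divr_ge0 // ltW.
have [N [BA|AB]] := cone_dichotomy A0 B0 eta0 rho_gt0 s_gt0 gap_s_lt_c eta_cvg growA growB.
  right; split.
    move=> M.
    have [n Nn MA] := unbounded_in_cone A0 B0 eta0 AB_gt0 gap_s_lt_c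
      rho0_lt eta_cvg rho_cvg growA BA (2 * M).
    exists n; have : A n <= 2 * normc (v n).
      apply: le_trans (le_normcB _ _) _.
      by rewrite normcM normc_repelling_point uv; lra.
    by move: MA; lra.
  have q0 n : 0 <= B n / A n by rewrite divr_ge0.
  have qc := quotient_cvg0_in_cone A0 B0 eta0 rho_gt0 AB_gt0 s_gt0 gap_s_lt_c
      eta_cvg growA growB BA.
  have [|N' N'P] := (cvg0P q0).1 qc (2^-1); first by rewrite invr_gt0.
  apply: (@cvg0_le _ _ (fun n => B n / A n) (4 * s / normc L) (maxn N N')) => //.
    by move=> n; exact: normc_ge0.
  move=> n; rewrite geq_max => /andP[Nn /N'P].
  have An : 0 < A n.
    rewrite lt_def A0 andbT; apply: contraTneq (AB_gt0 n) => An.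
    by have := BA _ Nn; rewrite An add0r -leNgt.
  rewrite ltr_pdivrMr // => h.
  have -> : normc (u n / v n - rm) = B n / normc (v n).
    rewrite -normcV -normcM; congr normc; rewrite mulrBl mulfK //.
  have : A n - B n <= 2 * s / normc L * normc (v n).
    rewrite -fixed_points_dist -normcM.
    rewrite (_ : (rm - rp) * v n = (u n - rp * v n) - (u n - rm * v n)); last by ring.
    exact: lerB_normc.
  move=> le; have le' : A n / 2 <= 2 * s / normc L * normc (v n) by lra.
  rewrite ler_pdivrMr //.
  rewrite (_ : 4 * s / normc L * (B n / A n) * normc (v n) =
    B n / A n * (2 * (2 * s / normc L * normc (v n)))); last by ring.
  apply: le_trans (_ : B n / A n * A n <= _); first by rewrite divfK ?gt_eqF.
  by rewrite ler_wpM2l //; lra.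
left.
have [C [r [C0 r0 r1 CP]]] := decay_outside_cone A0 B0 eta0 gap_s_lt_c rho0_lt eta_cvg rho_cvg growB AB.
have [|C' C'0 C'P] := @geometric_bound_eventually _ (fun n => normc (v n))
  (normc L / (2 * s) * C) r N r0 (fun n => normc_ge0 (v n)).
  have Ls : 0 <= normc L / (2 * s) by rewrite divr_ge0 ?mulr_ge0 // ltW.
  move=> n /CP /(ler_wpM2l Ls) h; rewrite -[_ * C * _]mulrA; apply: le_trans h.
  have := v_le n; rewrite mulrAC ler_pdivrMr // => vle.
  by rewrite mulrAC ler_pdivlMr ?mulr_gt0 //; move: vle; lra.
by exists C', r.
Qed.

Section Growing.
Let r n := u n / v n.
Hypothesis r_cvg : ccvg r rm.

Let r1 n : normc (r n) = 1.
Proof. by rewrite normcM normcV uv divff // gt_eqF. Qed.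

Let zr1 n : normc (zeta * r n) = 1.
Proof. by rewrite normcM gap_normc_zeta r1 mulr1. Qed.

Let rhoC_neq0 n : (rho n)%:C != 0.
Proof. by rewrite realC_eq0 gt_eqF. Qed.

Let uE n : u n = r n * v n. Proof. by rewrite /r divfK. Qed.

Let denE n : (rho n)%:C * v n.+1 = (1 - al n * (zeta * r n)) * v n.
Proof. by rewrite vS uE; ring. Qed.

Let den_neq0 n : 1 - al n * (zeta * r n) != 0.
Proof.
apply: contraTneq (v_neq0 n.+1) => d0; rewrite negbK -(mulrI_eq0 _ (lregP (rhoC_neq0 n))).
by rewrite denE d0 mul0r.
Qed.

Let rS n : r n.+1 = (zeta * r n - conjc (al n)) / (1 - al n * (zeta * r n)).
Proof.
have -> : r n.+1 = ((rho n)%:C * u n.+1) / ((rho n)%:C * v n.+1).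
  by rewrite -mulf_div divff // mul1r.
rewrite denE uS uE; move: (den_neq0 n) (v_neq0 n).
move: (1 - _) => d d0 vn0; by field; rewrite vn0 d0.
Qed.

(** At the limit the denominator [1 - L * zeta * rm] has modulus [c + s]; the indices of
    the coefficient and of the quotient are independent because the two steps compared
    below are mixed. *)
Let den_ge n k : normc (al n - L) <= s / 4 -> normc (r k - rm) <= s / 4 ->
  c + s / 2 <= normc (1 - al n * (zeta * r k)).
Proof.
move=> ha hr.
have h0 : normc (1 - L * (zeta * rm)) = c + s.
  rewrite attracting_denominator normcM gap_normc_e mul1r normc_realC ger0_norm //.
  by rewrite addr_ge0 // ltW.
have h1 : normc ((1 - L * (zeta * rm)) - (1 - al n * (zeta * r k))) <= s / 2.
  rewrite (_ : _ - _ = al n * (zeta * (r k - rm)) + zeta * rm * (al n - L)); last by ring.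
  apply: le_trans (le_normcD _ _) _.
  rewrite [normc (al n * _)]normcM [normc (zeta * rm * _)]normcM.
  rewrite [normc (zeta * (_ - _))]normcM [normc (zeta * rm)]normcM.
  rewrite gap_normc_zeta normc_attracting_point !mul1r.
  have := ler_pM (normc_ge0 (al n)) (normc_ge0 (r k - rm)) (ltW (al_lt1 n)) hr.
  by move: ha; lra.
have := lerB_normc (1 - L * (zeta * rm)) (1 - L * (zeta * rm) - (1 - al n * (zeta * r k))).
by rewrite subKr h0; move: h1; lra.
Qed.

(** The limiting map contracts by the factor [(c - s) / (c + s)] near its
    attracting point, so the variation of [r] is summable along with that of the
    coefficients. *)
Let r_bv : bv_cvg r rm.
Proof.
split => //.
have SL : `|S| < normc L.
  rewrite -(@ltr_pXn2r _ 2) ?nnegrE ?normc_ge0 // real_normK ?num_real // -sS.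
  by rewrite ltrDr exprn_gt0.
have [N1 N1P] := ccvg_normc_ge al_cvg.1 SL.
have s4 : 0 < s / 4 by rewrite divr_gt0.
have [N2 N2P] := ccvg_eps al_cvg.1 s4.
have [N3 N3P] := ccvg_eps r_cvg s4.
pose m := c + s / 2.
have m0 : 0 < m by rewrite addr_gt0 // divr_gt0.
have cm : c < m by rewrite /m ltrDl divr_gt0.
pose q := c ^+ 2 / m ^+ 2.
have q01 : 0 <= q < 1.
  rewrite divr_ge0 ?sqr_ge0 //= ltr_pdivrMr ?exprn_gt0 // mul1r.
  by rewrite ltr_pXn2r ?nnegrE // ltW.
apply: (@contraction_summable _ _ (fun n => 4 / m ^+ 2 * normc (al n.+1 - al n)) q
  (maxn N1 (maxn N2 N3)) q01).
- by move=> n; exact: normc_ge0.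
- by move=> n; rewrite mulr_ge0 ?normc_ge0 // divr_ge0 // sqr_ge0.
- move=> n; rewrite !geq_max => /andP[n1 /andP[n2 n3]].
  have d1 := den_ge (ltW (N2P _ (leqW n2))) (ltW (N3P _ (leqW n3))).
  have d2 := den_ge (ltW (N2P _ n2)) (ltW (N3P _ n3)).
  have d3 := den_ge (ltW (N2P _ (leqW n2))) (ltW (N3P _ n3)).
  have dn0 z : c + s / 2 <= normc z -> z != 0.
    by move=> h; rewrite -normc_gt0 (lt_le_trans m0).
  have al2 : 1 - (normc (al n.+1)) ^+ 2 <= c ^+ 2.
    have := N1P _ (leqW n1); rewrite -(@ler_pXn2r _ 2) ?nnegrE ?normc_ge0 //.
    by rewrite real_normK ?num_real //; move: cS; lra.
  rewrite (rS n.+1) {3}(rS n).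
  set a' := al n.+1 in d1 d3 al2 *; set a := al n in d2 *.
  set y' := r n.+1 in d1 *; set y := r n in d2 d3 *.
  set D1 := 1 - a' * (zeta * y') in d1 *; set D2 := 1 - a * (zeta * y) in d2 *.
  set D3 := 1 - a' * (zeta * y) in d3.
  (* One step from [y] with the new coefficient: it separates the effect of moving the
     point from that of moving the coefficient. *)
  pose M := (zeta * y - conjc a') / D3.
  apply: le_trans (le_dist_normc _ M _) _.
  have inv2 (z z' : R[i]) : m <= normc z -> m <= normc z' ->
      (normc (z * z'))^-1 <= (m ^+ 2)^-1.
    move=> h h'; have zz : 0 < normc z * normc z'.
      by rewrite mulr_gt0 // (lt_le_trans m0).
    by rewrite normcM lef_pV2 ?posrE ?exprn_gt0 // expr2 ler_pM // ltW.
  apply: lerD.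
    rewrite (_ : _ - M = zeta * (1 - conjc a' * a') * (y' - y) / (D1 * D3)); last first.
      rewrite /M /D1 /D3; field.
      by rewrite -/D1 -/D3 !dn0.
    rewrite !normcM normcV gap_normc_e !mul1r mulrAC.
    rewrite ler_wpM2r ?normc_ge0 // ler_pM ?normc_ge0 ?invr_ge0 ?normc_ge0 //.
      rewrite -sqr_normcE -(rmorph1 (real_complex R)) -rmorphB normc_realC ger0_norm //.
      by rewrite ltW // /a' sqr_al_lt1.
    exact: inv2.
  rewrite (_ : M - _ = ((zeta * y) ^+ 2 * (a' - a) - conjc (a' - a)
    + zeta * y * (a' * conjc (a' - a) - conjc a' * (a' - a))) / (D3 * D2)); last first.
    rewrite /M /D2 /D3 conjcB; field.
    by rewrite -/D2 -/D3 !dn0.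
  rewrite [normc (_ / _)]normcM normcV.
  rewrite [4 / _ * _]mulrAC ler_pM ?normc_ge0 ?invr_ge0 ?normc_ge0 //; last exact: inv2.
  have h1 := le_normcD ((zeta * y) ^+ 2 * (a' - a) - conjc (a' - a))
    (zeta * y * (a' * conjc (a' - a) - conjc a' * (a' - a))).
  have h2 := le_normcB ((zeta * y) ^+ 2 * (a' - a)) (conjc (a' - a)).
  have h3 := le_normcB (a' * conjc (a' - a)) (conjc a' * (a' - a)).
  have h4 : normc a' * normc (a' - a) <= normc (a' - a).
    by rewrite ler_piMl ?normc_ge0 // ltW // al_lt1.
  move: h1 h2 h3; rewrite [normc (zeta * y * _)]normcM [normc (_ ^+ 2 * _)]normcM normcX.
  rewrite zr1 expr1n !mul1r [normc (a' * _)]normcM [normc (conjc a' * _)]normcM !normc_conj.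
  by move: h4; lra.
- apply: (@is_cvg_seriesZ _ (fun n => normc (al n.+1 - al n)) _).
  exact: al_cvg.2.
Qed.

Variables (K : nat -> R).
Hypothesis K_gt0 : forall n, 0 < K n.
Hypothesis KS : forall n, K n.+1 = K n + (normc (v n.+1)) ^+ 2.

Let x n : R[i] := (K n / (normc (v n)) ^+ 2)%:C.

Let den_bv : bv_cvg (fun n => 1 - al n * (zeta * r n)) (e * (c + s)%:C).
Proof.
rewrite -attracting_denominator; apply: bv_cvgB; first exact: bv_cvg_cst.
by apply: bv_cvgM => //; apply: bv_cvgM => //; exact: bv_cvg_cst.
Qed.

(** [x n.+1 = 1 + x n * g n] with [g n = |v n|^2 / |v n.+1|^2], which the recursion
    expresses through the coefficient and the quotient. *)
Let x_bv : bv_cvg x ((c + s) / (2 * s))%:C.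
Proof.
have cs0 : 0 < c + s by rewrite addr_gt0.
pose g n := (1 - conjc (al n) * al n) /
  (conjc (1 - al n * (zeta * r n)) * (1 - al n * (zeta * r n))).
have g_bv : bv_cvg g ((c - s) / (c + s))%:C.
  have -> : ((c - s) / (c + s))%:C = (1 - conjc L * L) /
      (conjc (e * (c + s)%:C) * (e * (c + s)%:C)).
    rewrite conjcM mulrACA gap_ee mul1r conjc_real -sqr_normcE -sS.
    rewrite -(rmorph1 (real_complex R)) -rmorphB -rmorphM -fmorph_div /=; congr _%:C.
    by rewrite -cS; field; rewrite gt_eqF.
  apply: bv_cvgM.
    apply: bv_cvgB; first exact: bv_cvg_cst.
    by apply: bv_cvgM => //; exact: bv_cvg_conj.
  apply: bv_cvgV; last by apply: bv_cvgM => //; exact: bv_cvg_conj.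
  by rewrite conjcM mulrACA gap_ee mul1r conjc_real mulf_neq0 // realC_eq0 gt_eqF.
have -> : ((c + s) / (2 * s))%:C = (1 - ((c - s) / (c + s))%:C)^-1.
  rewrite -(rmorph1 (real_complex R)) -rmorphB -fmorphV /=; congr _%:C.
  field; rewrite !gt_eqF //.
  by rewrite (_ : c + s - (c - s) = 2 * s) ?mulr_gt0 //; ring.
apply: bv_cvg_affine g_bv _; last first.
  have sc := gap_s_lt_c.
  rewrite normc_realC ger0_norm; last by rewrite divr_ge0 ?subr_ge0 // ltW.
  by rewrite ltr_pdivrMr // mul1r; move: s_gt0; lra.
move=> n; rewrite /x KS /g.
have vv k : ((normc (v k)) ^+ 2)%:C != 0 by rewrite realC_eq0 sqrf_eq0 gt_eqF.
have E : ((normc (v n.+1)) ^+ 2)%:C * (1 - conjc (al n) * al n) =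
    ((normc (v n)) ^+ 2)%:C *
    (conjc (1 - al n * (zeta * r n)) * (1 - al n * (zeta * r n))).
  rewrite -sqr_rhoC !sqr_normcE.
  have := denE n => /(congr1 (fun z => conjc z * z)); rewrite !conjcM conjc_real => h.
  transitivity ((rho n)%:C * conjc (v n.+1) * ((rho n)%:C * v n.+1)); first by ring.
  by rewrite h; ring.
have dn := den_neq0 n.
have dn' : conjc (1 - al n * (zeta * r n)) != 0 by rewrite conjc_eq0.
have -> : (1 - conjc (al n) * al n) /
    (conjc (1 - al n * (zeta * r n)) * (1 - al n * (zeta * r n))) =
    ((normc (v n)) ^+ 2)%:C / ((normc (v n.+1)) ^+ 2)%:C.
  by apply/eqP; rewrite eqr_div ?mulf_neq0 // mulrC E.
rewrite -(rmorph1 (real_complex R)) -fmorph_div -rmorphM -rmorphD /=; congr _%:C.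
by field; rewrite !gt_eqF.
Qed.

(** [Delta n] is [(conj (zeta r n) - al n) / x n], a rational expression in
    sequences of bounded variation. *)
Lemma gap_Delta_cvg :
  bv_cvg (fun n => (rho n)%:C * conjc (u n.+1) * v n / (K n)%:C)
    (- ((2 * s)%:C * conjc w) / conjc L).
Proof.
have L0 := gap_L_neq0.
have L0' : conjc L != 0 by rewrite conjc_eq0.
have cs0 : 0 < c + s by rewrite addr_gt0.
have -> : - ((2 * s)%:C * conjc w) / conjc L =
    (conjc (zeta * rm) - L) / ((c + s) / (2 * s))%:C.
  have s2 : (2 * s)%:C != 0 by rewrite realC_eq0 gt_eqF // mulr_gt0.
  have csC : (c + s)%:C != 0 by rewrite realC_eq0 gt_eqF.
  have zrm : zeta * rm = - (e * w) / L.
    rewrite /rm; transitivity (- (conjc e * e) * (e * w) / L); first by field.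
    by rewrite gap_ee; field.
  have -> : ((c + s) / (2 * s))%:C = (c + s)%:C / (2 * s)%:C by rewrite fmorph_div.
  rewrite zrm !conjcM conjcN conjcM conjcV.
  have -> : - (conjc e * conjc w) / conjc L - L = - (conjc w * (c + s)%:C) / conjc L.
    rewrite -gap_ceDw mulrDr gap_ww; by field.
  move: s2 csC; move: (2 * s)%:C (c + s)%:C => s2 csC s20 csC0.
  by field; rewrite L0' s20 csC0.
have -> : (fun n => (rho n)%:C * conjc (u n.+1) * v n / (K n)%:C) =
    (fun n => (conjc (zeta * r n) - al n) / x n).
  apply/funext => n; have vn := v_neq0 n.
  have Kn : (K n)%:C != 0 by rewrite realC_eq0 gt_eqF.
  have -> : (rho n)%:C * conjc (u n.+1) = conjc (zeta * u n - conjc (al n) * v n).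
    by rewrite -uS conjcM conjc_real.
  rewrite /x fmorph_div /= sqr_normcE uE !(conjcB, conjcM, conjcK).
  have vn' : conjc (v n) != 0 by rewrite conjc_eq0.
  by move: Kn; move: (K n)%:C => k k0; field; rewrite k0 vn vn'.
apply: bv_cvgM; last first.
  by apply: bv_cvgV => //; rewrite realC_eq0 gt_eqF // divr_gt0 // mulr_gt0.
apply: bv_cvgB => //; apply: bv_cvg_conj.
by apply: bv_cvgM => //; exact: bv_cvg_cst.
Qed.

End Growing.
End GapDynamics.

(** * Angles and the effect of an atom *)

Section GapAngle.
Context {R : realType}.
Implicit Types (theta : R) (L : R[i]).

Lemma expi_half theta :
  expi theta = (cos (theta / 2) +i* sin (theta / 2)) * (cos (theta / 2) +i* sin (theta / 2)).
Proof.
rewrite /expi [in LHS](splitr theta) cosD sinD; simpc; congr (_ +i* _).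
by rewrite [sin _ * cos _ + _]addrC.
Qed.

Lemma gap_angle theta (l : R) : 0 <= l -> l < 1 -> - (2 * asin l) < theta < 2 * asin l ->
  0 < cos (theta / 2) /\ `|sin (theta / 2)| < l.
Proof.
move=> l0 l1 /andP[t1 t2].
have l11 : -1 <= l <= 1 by lra.
have a1 : asin l < pi / 2 by rewrite asin_ltpi2 // l1; lra.
have a2 : - (pi / 2) <= asin l by exact: asin_geNpi2.
have p0 := pi_gt0 R.
have pos x : - asin l < x < asin l -> sin x < l.
  move=> xl; rewrite -[ltRHS]asinK ?in_itv //= ltr_sin ?in_itv /=; lra.
split; first by apply: cos_gt0_pihalf; lra.
rewrite ltr_norml pos; last by lra.
by rewrite andbT ltrNl -sinN pos //; lra.
Qed.

Lemma angle_exists (x y : R) : x ^+ 2 + y ^+ 2 = 1 ->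
  exists omega, cos omega = x /\ sin omega = y.
Proof.
move=> xy; have y2 := sqr_ge0 y.
have x1 : -1 <= x <= 1 by rewrite -ler_norml -sqrtr_sqr -sqrtr1 ler_wsqrtr //; lra.
have sE : sin (acos x) = `|y|.
  by rewrite sin_acos // -sqrtr_sqr; congr Num.sqrt; lra.
have cE : cos (acos x) = x by apply: acosK; rewrite in_itv.
have [y0|y0] := leP 0 y.
  by exists (acos x); split => //; rewrite sE ger0_norm.
by exists (- acos x); rewrite cosN sinN sE ltr0_norm // opprK.
Qed.

(** The principal square root has nonnegative real part. *)
Lemma sqrtc_unique (z h : R[i]) : z ^+ 2 = h -> 0 < complex.Re z -> sqrtc h = z.
Proof.
move=> zh z0; have : sqrtc h ^+ 2 = z ^+ 2 by rewrite sqr_sqrtc.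
move=> /eqP; rewrite eqf_sqr => /predU1P[//|/eqP hz].
have : 0 <= complex.Re (sqrtc h) by case: (h) => a b /=; exact: sqrtr_ge0.
by rewrite hz; case: (z) z0 => a b /= a0; rewrite oppr_ge0 leNgt a0.
Qed.

End GapAngle.

Section Atoms.
Context {R : realType}.
Variable mu : probability (borelC R) R.
Hypothesis mu_pos : forall p : {poly R[i]}, p != 0 -> 0 < norm2 mu p.
Variable zeta : R[i].
Hypothesis zeta1 : normc zeta = 1.
Local Notation phi := (orthonormal_op mu).

Lemma norm2_orthonormal n : norm2 mu (phi n) = 1.
Proof.
have N0 := norm2_monic_gt0 mu_pos n.
have N0' : (norm2 mu (monic_op mu n))%:C != 0 by rewrite realC_eq0 gt_eqF.
apply/eqP; rewrite -(@eqrXn2 _ 2) ?norm2_ge0 // expr1n; apply/eqP/(@complexI R).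
rewrite -inner_norm2 /orthonormal_op innerZl innerZr conjc_real inner_norm2.
by rewrite rmorphXn fmorphV /= expr2 mulKf // mulVf.
Qed.

(** The atom alone contributes [mu {zeta} * |phi_n(zeta)|^2] to the squared norm of
    [phi_n], which is 1. *)
Lemma orthonormal_bounded_at_atom : (0 < mu [set zeta])%E ->
  exists M, forall n, normc (phi n).[zeta] <= M.
Proof.
move=> m0; exists (1 / Num.sqrt (fine (mu [set zeta]))) => n.
by rewrite -(norm2_orthonormal n); exact: eval_le_norm2_atom.
Qed.

(** Without an atom the kernel diverges: the peak polynomials take the value 1 at
    [zeta] although their norms tend to 0. *)
Lemma kernel_unbounded_off_atom M : mu [set zeta] = 0%E ->
  ~ (forall n, CD_kernel mu n zeta <= M).
Proof.
move=> mz KM; have M1 : 0 < `|M| + 1 by rewrite ltr_wpDl.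
have [m mP] := norm2_peak_small zeta1 mz (divr_gt0 ltr01 M1).
have := @eval_le_kernel _ mu mu_pos zeta (size (peak zeta m)) (peak zeta m) (leqnSn _).
rewrite peak_zeta // normc1 expr1n leNgt => /negP; apply.
apply: le_lt_trans (_ : (`|M| + 1) * norm2 mu (peak zeta m) ^+ 2 < 1).
  rewrite ler_wpM2r ?sqr_ge0 //; apply: le_trans (KM _) _.
  by apply: le_trans (ler_norm M) _; rewrite lerDl.
by rewrite mulrC -ltr_pdivlMr.
Qed.

Lemma kernel_bounded_of_decay C r : 0 < r < 1 ->
  (forall n, normc (phi n).[zeta] <= C * r ^+ n) ->
  exists M, forall n, CD_kernel mu n zeta <= M.
Proof.
move=> /andP[r0 r1] le.
have d0 n : 0 <= (normc (phi n).[zeta]) ^+ 2 by exact: sqr_ge0.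
have [|M MP] := (summableP d0).1.
  apply: (@summable_le _ _ (geometric (C ^+ 2) (r ^+ 2)) 0) => //.
  - by move=> n /=; rewrite mulr_ge0 ?sqr_ge0 // exprn_ge0 // sqr_ge0.
  - move=> n _ /=; rewrite exprAC -exprMn lerXn2r ?nnegrE ?normc_ge0 //.
    exact: le_trans (normc_ge0 _) (le n).
  - by apply: is_cvg_geometric_series; rewrite ger0_norm ?sqr_ge0 // expr_lt1 // ltW.
exists M => n; apply: le_trans (MP n.+1).
by rewrite /series /= big_mkord.
Qed.

End Atoms.

(** * The recursion at a point of the circle *)

Section PointEvaluation.
Context {R : realType}.
Variable mu : probability (borelC R) R.
Hypothesis mu_pos : forall p : {poly R[i]}, p != 0 -> 0 < norm2 mu p.
Variable zeta : R[i].
Hypothesis zeta1 : normc zeta = 1.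
Local Notation phi := (orthonormal_op mu).
Local Notation alpha := (verblunsky mu).
Local Notation rho n := (Num.sqrt (1 - (normc (alpha n)) ^+ 2)).
Local Notation u n := (phi n).[zeta].
Local Notation v n := (rev_poly n (phi n)).[zeta].

Let N_neq0 n : (norm2 mu (monic_op mu n))%:C != 0.
Proof. by rewrite realC_eq0 gt_eqF // norm2_monic_gt0. Qed.

Let rhoC n : (rho n)%:C =
  (norm2 mu (monic_op mu n.+1))%:C / (norm2 mu (monic_op mu n))%:C.
Proof. by rewrite sqrt_1_sub_alpha // fmorph_div. Qed.

Lemma orthonormal_recursion n :
  (rho n)%:C * u n.+1 = zeta * u n - conjc (alpha n) * v n.
Proof.
rewrite rhoC !horner_orthonormal_op horner_rev_orthonormal_op szego_recursion_horner //.
move: (N_neq0 n) (N_neq0 n.+1); move: (norm2 _ _)%:C (norm2 _ _)%:C => a b a0 b0.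
by field; rewrite a0 b0.
Qed.

Lemma rev_orthonormal_recursion n :
  (rho n)%:C * v n.+1 = v n - alpha n * zeta * u n.
Proof.
rewrite rhoC horner_orthonormal_op !horner_rev_orthonormal_op.
rewrite szego_recursion_rev_horner //.
move: (N_neq0 n) (N_neq0 n.+1); move: (norm2 _ _)%:C (norm2 _ _)%:C => a b a0 b0.
by field; rewrite a0 b0.
Qed.

Lemma normc_rev_orthonormal n : normc (u n) = normc (v n).
Proof. by rewrite normc_rev_poly // size_orthonormal_op. Qed.

(** By the recursion a zero of [v n.+1] would force [|v n| = |alpha n| |u n|], whereas
    [|u n| = |v n|] and [|alpha n| < 1]. *)
Lemma rev_orthonormal_neq0 n : v n != 0.
Proof.
elim: n => [|n ih].
  rewrite horner_rev_orthonormal_op (monic_orthogonal_uniq mu_pos (monic_opP mu_pos 0)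
    (monic_orthogonal0 mu)).
  rewrite horner_rev_poly_circle ?size_poly1 // expr0 mul1r hornerC conjc1 mul1r.
  by rewrite invr_eq0 realC_eq0 gt_eqF // mu_pos // oner_neq0.
apply: contraTneq (normc_verblunsky_lt1 mu_pos n) => v0; rewrite -leNgt.
have := rev_orthonormal_recursion n; rewrite v0 mulr0 => /eqP.
rewrite eq_sym subr_eq0 => /eqP /(congr1 (@normc R)).
rewrite !normcM zeta1 mulr1 normc_rev_orthonormal => E.
by rewrite -(ler_pM2r (_ : 0 < normc (v n))) ?normc_gt0 // mul1r -E.
Qed.

Lemma CD_kernel_revS n :
  CD_kernel mu n.+1 zeta = CD_kernel mu n zeta + (normc (v n.+1)) ^+ 2.
Proof. by rewrite CD_kernelS normc_rev_orthonormal. Qed.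

End PointEvaluation.

Section ExponentialDecay.
Context {R : realType}.

Lemma exponentially_small_Delta (mu : probability (borelC R) R) (zeta : R[i]) gamma C r :
  (forall p : {poly R[i]}, p != 0 -> 0 < norm2 mu p) -> normc zeta = 1 ->
  0 < gamma < 1 -> 0 < C -> 0 < r < 1 ->
  (forall n, normc (orthonormal_op mu n).[zeta] <= C * r ^+ n) ->
  exponentially_small (Delta mu gamma zeta).
Proof.
move=> mu_pos zeta1 /andP[g0 g1] C0 /andP[r0 r1] le.
have c0 : 0 < (1 - gamma) * gamma^-1 by rewrite mulr_gt0 ?invr_gt0 // subr_gt0.
exists (C ^+ 2 / ((1 - gamma) * gamma^-1)), r; split => // [|n].
  by rewrite divr_gt0 // exprn_gt0.
have rn : 0 < r ^+ n by exact: exprn_gt0.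
rewrite /Delta !normcM normcV !normc_realC normc_conj.
rewrite -(normc_rev_orthonormal mu_pos zeta1) [leRHS]mulrAC.
apply: ler_pM; rewrite ?invr_ge0 ?mulr_ge0 ?normc_ge0 ?normr_ge0 //.
  rewrite expr2 -[C * C * _]mulrA; apply: ler_pM; rewrite ?mulr_ge0 ?normc_ge0 ?normr_ge0 //.
    apply: le_trans (_ : 1 * C <= _); last by rewrite mul1r.
    apply: ler_pM; rewrite ?normc_ge0 ?normr_ge0 //.
      by rewrite ger0_norm ?sqrtr_ge0 // -[leRHS]sqrtr1 ler_wsqrtr // lerBlDr lerDl sqr_ge0 //.
    apply: le_trans (le _) _; rewrite ler_piMr ?(ltW C0) //.
    by rewrite exprn_ile1 // ltW.
have K0 := CD_kernel_ge0 mu zeta n.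
rewrite ger0_norm; last by rewrite addr_ge0 // ltW.
by rewrite lef_pV2 ?posrE ?lerDl // ltr_pwDl.
Qed.

End ExponentialDecay.

(** * Perturbation of the Verblunsky coefficients by a point mass *)

Unset Implicit Arguments.

Theorem theorem2p1 (R : realType)
  (mu : probability (borelC R) R)
  (mu_circle : mu unit_circle = 1%E)
  (mu_infinite : infinite_set (msupport mu))
  (L : R[i]) (L_neq0 : L != 0) (L_lt1 : normc L < 1)
  (alpha_cvg : (verblunsky mu : nat -> R[i]^o) @ \oo --> (L : R[i]^o))
  (alpha_bv : bounded_var (verblunsky mu))
  (theta : R)
  (theta_gap : - (2 * asin (normc L)) < theta < 2 * asin (normc L))
  (gamma : R) (gamma_01 : 0 < gamma < 1)
  (nu : probability (borelC R) R)
  (nu_def : forall A : set (borelC R), measurable A ->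
     nu A = ((1 - gamma)%:E * mu A + gamma%:E * \d_(expi theta : borelC R) A)%E) :
  let zeta := expi theta in
  let D := Delta mu gamma zeta in
  let Dinf := lim ((D : nat -> R[i]^o) @ \oo) in
  let h := (zeta - 1) ^+ 2 + 4 * zeta * ((normc L) ^+ 2)%:C in
  ((0 < mu [set zeta])%E ->
     [/\ exponentially_small (fun n => (normc (orthonormal_op mu n).[zeta])%:C),
         exponentially_small D &
         exponentially_small (fun n => verblunsky nu n - verblunsky mu n)])
  /\
  (mu [set zeta] = 0%E ->
     [/\ cvgn (D : nat -> R[i]^o) /\
           Dinf = conjc (sqrtc h) * (((zeta - 1) - sqrtc h) / (2 * conjc L)),
         normc (Dinf + L) = normc L,
         exists omega : R,
           [/\ cos omega =
                 (2 * sin (theta / 2) ^+ 2 - (normc L) ^+ 2) / (normc L) ^+ 2,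
               sin omega =
                 2 * sin (theta / 2)
                 * Num.sqrt ((normc L) ^+ 2 - sin (theta / 2) ^+ 2)
                 / (normc L) ^+ 2 &
               (verblunsky nu : nat -> R[i]^o) @ \oo -->
                 (L * expi omega : R[i]^o)] &
         bounded_var D]).
Proof.
move=> zeta D Dinf h.
have zeta1 : normc zeta = 1 by exact: normc_expi.
have mu_pos p : p != 0 -> 0 < norm2 mu p by exact: norm2_gt0.
have nu_pos p : p != 0 -> 0 < norm2 nu p.
  apply: norm2_gt0; first exact: circle_point_mass nu_def mu_circle.
  apply: sub_infinite_set mu_infinite; exact: msupport_point_mass gamma_01 nu_def.
have nuD n : verblunsky nu n = verblunsky mu n + D n.
  apply: verblunsky_point_mass => // p q.
  exact: inner_point_mass zeta1 gamma_01 nu_def p q.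
have [c0 SL] := gap_angle (normc_ge0 L) L_lt1 theta_gap.
set S := sin (theta / 2) in SL *; set c := cos (theta / 2) in c0.
set s := Num.sqrt _; set l := normc L in L_lt1 SL s *.
have l0 : 0 < l by rewrite normc_gt0.
have S2 : S ^+ 2 < l ^+ 2.
  by rewrite -real_normK ?num_real // ltr_pXn2r ?nnegrE ?normr_ge0 // ltW.
have s0 : 0 < s by rewrite sqrtr_gt0 subr_gt0.
have s2 : s ^+ 2 = l ^+ 2 - S ^+ 2 by rewrite sqr_sqrtr // subr_ge0 ltW.
have cS : c ^+ 2 + S ^+ 2 = 1 by exact: cos2Dsin2.
have sS : s ^+ 2 + S ^+ 2 = normc L ^+ 2 by rewrite s2 subrK.
have zetaE : zeta = (c +i* S) * (c +i* S) by exact: expi_half.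
have al_bv : bv_cvg (verblunsky mu) L by split => //; apply/ccvgP.
have alt := gap_alternative c0 s0 cS sS L_lt1 (normc_verblunsky_lt1 mu_pos)
  (fun=> erefl) _ _ (normc_rev_orthonormal mu_pos zeta1)
  (rev_orthonormal_neq0 mu_pos zeta1) al_bv.
rewrite -zetaE in alt.
have {alt} := alt (orthonormal_recursion mu_pos zeta)
  (rev_orthonormal_recursion mu_pos zeta1).
move=> alt; split => [m0|mz].
- have [M uM] := orthonormal_bounded_at_atom mu_pos zeta1 m0.
  case: alt => [[C [r [C0 r0 r1 vC]]]|[unb _]]; last first.
    (* The growing alternative is incompatible with the bound from the atom. *)
    have [n] := unb M.
    by rewrite -(normc_rev_orthonormal mu_pos zeta1) ltNge uM.
  have uC n : normc (orthonormal_op mu n).[zeta] <= C * r ^+ n.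
    by rewrite (normc_rev_orthonormal mu_pos zeta1) vC.
  have r01 : 0 < r < 1 by rewrite r0.
  have De : exponentially_small D.
    exact: exponentially_small_Delta mu_pos zeta1 gamma_01 C0 r01 uC.
  split => //.
    exists C, r; split => // n; rewrite normc_realC ger0_norm ?normc_ge0 //.
  rewrite (_ : (fun n => _) = D) //.
  by apply/funext => n; rewrite nuD addrC addKr.
- case: alt => [[C [r [C0 r0 r1 vC]]]|[_ rcvg]].
    have uC n : normc (orthonormal_op mu n).[zeta] <= C * r ^+ n.
      by rewrite (normc_rev_orthonormal mu_pos zeta1) vC.
    have r01 : 0 < r < 1 by rewrite r0.
    have [M KM] := kernel_bounded_of_decay r01 uC.
    by have := kernel_unbounded_off_atom mu_pos zeta1 mz KM.
  have Kpos n : 0 < (1 - gamma) * gamma^-1 + CD_kernel mu n zeta.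
    have [g0 g1] := andP gamma_01.
    by rewrite ltr_pwDl ?CD_kernel_ge0 // mulr_gt0 ?invr_gt0 // subr_gt0.
  have KS n : (1 - gamma) * gamma^-1 + CD_kernel mu n.+1 zeta =
      (1 - gamma) * gamma^-1 + CD_kernel mu n zeta +
      (normc (rev_poly n.+1 (orthonormal_op mu n.+1)).[zeta]) ^+ 2.
    by rewrite CD_kernel_revS // addrA.
  have Dl := gap_Delta_cvg c0 s0 cS sS L_lt1 (normc_verblunsky_lt1 mu_pos)
    (fun=> erefl) _ _ (normc_rev_orthonormal mu_pos zeta1)
    (rev_orthonormal_neq0 mu_pos zeta1) al_bv rcvg Kpos KS.
  rewrite -zetaE in Dl.
  pose w := s +i* S; pose e := c +i* S.
  have {}Dl : bv_cvg D (- ((2 * s)%:C * conjc w) / conjc L).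
    exact: Dl (orthonormal_recursion mu_pos zeta) (rev_orthonormal_recursion mu_pos zeta1).
  set Dlim := - _ / _ in Dl.
  have Dc := (ccvgP _ _).1 Dl.1.
  have DinfE : Dinf = Dlim by apply: cvg_lim => //; exact: norm_hausdorff.
  have L0' : conjc L != 0 by rewrite conjc_eq0.
  have ww : conjc w * w = conjc L * L by exact: gap_ww sS.
  have wDw : (2 * s)%:C = w + conjc w by rewrite gap_wDw.
  have ee : conjc e * e = 1 by exact: gap_ee cS.
  have ew : e - conjc e = w - conjc w by simpc; congr (_ +i* _); ring.
  have sqrthE : sqrtc h = (2 * s)%:C * e.
    apply: sqrtc_unique; last by rewrite /= mul0r subr0 !mulr_gt0.
    rewrite /h zetaE -/e [(_ ^+ 2)%:C]sqr_normcE -ww wDw.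
    transitivity ((e * (e - conjc e) + ((conjc e * e) - 1)) ^+ 2
        + 4 * (e * e) * (conjc w * w)); last first.
      by congr (_ ^+ 2 + _); ring.
    by rewrite ee subrr addr0 ew; ring.
  (* [w = s + i S] has modulus [|L|], so this limit has modulus [|L|] too. *)
  have sumE : Dlim + L = - (conjc w * conjc w) / conjc L.
    rewrite /Dlim wDw; transitivity ((- ((w + conjc w) * conjc w) + conjc L * L) / conjc L).
      by field.
    by rewrite -ww; congr (_ / _); ring.
  split.
  + split; first exact: cvgP Dc.
    rewrite DinfE sqrthE /Dlim conjcM conjc_real zetaE -/e.
    rewrite (_ : e * e - 1 - (2 * s)%:C * e = - 2 * conjc w * e); last first.
      transitivity (e * (e - conjc e) + (conjc e * e - 1) - (2 * s)%:C * e); first by ring.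
      by rewrite ee subrr addr0 ew wDw; ring.
    move: (2 * s)%:C => t.
    transitivity (- (t * conjc w) * (conjc e * e) / conjc L); first by rewrite ee mulr1.
    by field.
  + rewrite DinfE sumE normcM normcN normcM normcV !normc_conj (gap_normc_w sS).
    by rewrite mulfK // gt_eqF.
  + pose x := (2 * S ^+ 2 - l ^+ 2) / l ^+ 2; pose y := 2 * S * s / l ^+ 2.
    have lC0 : (l ^+ 2)%:C != 0 by rewrite realC_eq0 gt_eqF // exprn_gt0.
    have xy : x ^+ 2 + y ^+ 2 = 1.
      rewrite /x /y !exprMn exprVn s2; field; exact: lt0r_neq0.
    have [om [cosE sinE]] := angle_exists xy; exists om.
    split; [exact: cosE|exact: sinE|].
    have -> : L * expi om = L + Dlim.
      rewrite addrC sumE /expi cosE sinE.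
      have -> : x +i* y = - (conjc w * conjc w) / (l ^+ 2)%:C.
        have l20 : l ^+ 2 != 0 by rewrite gt_eqF // exprn_gt0.
        have -> : x = (S ^+ 2 - s ^+ 2) / l ^+ 2 by rewrite s2 /x; congr (_ / _); ring.
        apply: (mulIf lC0); rewrite divfK // /y /w; simpc.
        by rewrite !divfK //; congr (_ +i* _); ring.
      by rewrite sqr_normcE; field; rewrite L_neq0 L0'.
    have -> : verblunsky nu = fun n => verblunsky mu n + D n by apply/funext.
    exact: (ccvgP _ _).1 (bv_cvgD al_bv Dl).1.
  + exact: Dl.2.
Qed.
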